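(* Let $S_1,S_2$ be base spaces with Radon measures $\lambda_1,\lambda_2$, and let $\mathcal W:L^2(S_1,\lambda_1)\to L^2(S_2,\lambda_2)$ be a partial isometry such that both $\mathcal W$ and $\mathcal W^*$ are locally Hilbert--Schmidt operators, with integral kernel $W:S_2\times S_1\to\mathbb C$. For measurable $\Lambda_1\subset S_1$, $\Lambda_2\subset S_2$ put $$K_{S_1}^{(\Lambda_2)}(x,x')=\int_{\Lambda_2}\overline{W(y,x)}\,W(y,x')\,\lambda_2(dy),\qquad K_{S_2}^{(\Lambda_1)}(y,y')=\int_{\Lambda_1}W(y,x)\,\overline{W(y',x)}\,\lambda_1(dx).$$ Let $(\Xi_1^{(\Lambda_2)},K_{S_1}^{(\Lambda_2)},\lambda_1(dx))$ and $(\Xi_2^{(\Lambda_1)},K_{S_2}^{(\Lambda_1)},\lambda_2(dy))$ be the determinantal point processes on $S_1$ and $S_2$ associated with these kernels. Then $\Xi_1^{(\Lambda_2)}(\Lambda_1)$ and $\Xi_2^{(\Lambda_1)}(\Lambda_2)$ are equal in law, i.e. $$\mathbf P\big(\Xi_1^{(\Lambda_2)}(\Lambda_1)=m\big)=\mathbf P\big(\Xi_2^{(\Lambda_1)}(\Lambda_2)=m\big)\qquad\text{for all } m\in\mathbb N_0.$$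
   Context: $\mathbb N_0=\{0,1,2,\dots\}$. A base space $S$ is a locally compact Hausdorff space with countable base, equipped with a Radon measure $\lambda$. A point process on $S$ is a random variable $\Xi=\sum_j\delta_{X_j}$ with values in the set $\mathrm{Conf}(S)$ of nonnegative-integer-valued Radon measures on $S$ (with the Borel $\sigma$-field of the vague topology); it is simple if $\Xi(\{x\})\in\{0,1\}$ for every $x\in S$. A symmetric measure $\lambda^n$ on $S^n$ is the $n$-th correlation measure of $\Xi$ if $\mathbf E\big[\prod_{j=1}^m \frac{\Xi(\Lambda_j)!}{(\Xi(\Lambda_j)-k_j)!}\big]=\lambda^n(\Lambda_1^{k_1}\times\cdots\times\Lambda_m^{k_m})$ for all disjoint bounded $\Lambda_1,\dots,\Lambda_m\subset S$ and $k_j\in\mathbb N_0$ with $\sum_j k_j=n$ (the quotient is $0$ if $\Xi(\Lambda_j)<k_j$); its density $\rho^n$ with respect to $\lambda^{\otimes n}$ is the $n$-point correlation function. A determinantal point process (DPP) $(\Xi,K,\lambda)$ with correlation kernel $K:S\times S\to\mathbb C$ is a simple point process whose correlation functions are $\rho^n(x_1,\dots,x_n)=\det_{1\le j,k\le n}[K(x_j,x_k)]$ for every $n\in\mathbb N$ (as densities with respect to $\lambda^{\otimes n}$). A bounded linear operator $\mathcal W:H_1\to H_2$ between Hilbert spaces is a partial isometry if $\|\mathcal Wf\|_{H_2}=\|f\|_{H_1}$ for all $f\in(\ker\mathcal W)^\perp$. For measurable $\Lambda$, $\mathcal P_\Lambda$ denotes multiplication by $\mathbf 1_\Lambda$. A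 bounded operator $\mathcal A:L^2(S,\lambda)\to L^2(S',\lambda')$ is locally Hilbert--Schmidt if $\mathcal A\mathcal P_\Lambda$ is Hilbert--Schmidt for every compact $\Lambda\subset S$. The integral kernel $W$ of $\mathcal W$ is the measurable function with $(\mathcal Wf)(y)=\int_{S_1}W(y,x)f(x)\lambda_1(dx)$ and $(\mathcal W^*g)(x)=\int_{S_2}\overline{W(y,x)}g(y)\lambda_2(dy)$ (for $f,g$ vanishing outside compact sets, and by $L^2$-limits in general), such that $x\mapsto\|W(\cdot,x)\|_{L^2(S_2,\lambda_2)}$ and $y\mapsto\|W(y,\cdot)\|_{L^2(S_1,\lambda_1)}$ are square integrable on compact sets. The kernels $K_{S_1}^{(\Lambda_2)}$, $K_{S_2}^{(\Lambda_1)}$ are the integral kernels of $\mathcal W^*\mathcal P_{\Lambda_2}\mathcal W$ and $\mathcal W\mathcal P_{\Lambda_1}\mathcal W^*$. *)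

(* Defs.v *)
From HB Require Import structures.
From mathcomp Require Import all_boot all_order all_algebra all_fingroup.
From mathcomp Require Import all_classical all_reals all_analysis.
From mathcomp Require Import complex.

Set Implicit Arguments.
Unset Strict Implicit.
Unset Printing Implicit Defensive.

Import Order.TTheory GRing.Theory Num.Theory.
Import numFieldNormedType.Exports.

Local Open Scope classical_set_scope.
Local Open Scope ring_scope.
Local Open Scope complex_scope.

HB.mixin Record isBaseSpace (d : measure_display) T
    & Measurable d T & Topological T := {
  measurable_borelE : @measurable d T = <<s @open T >> ;
  base_hausdorff : hausdorff_space T ;
  base_locally_compact : locally_compact [set: T] ;
  base_second_countable : @second_countable T
}.

#[short(type="baseSpaceType")]
HB.structure Definition BaseSpace (d : measure_display) :=
  {T of Measurable d T & Topological T & isBaseSpace d T}.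

Section base_space.
Context (R : realType) (d : measure_display) (S : baseSpaceType d).
Local Open Scope ereal_scope.

Definition radon (mu : set S -> \bar R) : Prop :=
  [/\ forall K : set S, compact K -> mu K < +oo,
      forall A : set S, measurable A ->
        mu A = ereal_inf [set mu U | U in [set U | open U /\ A `<=` U]]
    & forall U : set S, open U ->
        mu U = ereal_sup [set mu K | K in [set K | compact K /\ K `<=` U]]].

Definition bounded_borel (A : set S) : Prop :=
  measurable A /\ exists2 K : set S, compact K & A `<=` K.

Definition integer_valued (mu : set S -> \bar R) : Prop :=
  forall A, measurable A -> mu A = +oo \/ exists n : nat, mu A = n%:R%:E.

End base_space.

Record conf (R : realType) (d : measure_display) (S : baseSpaceType d) := Conf {
  conf_measure :> {measure set S -> \bar R} ;
  conf_radon : radon conf_measure ;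
  conf_integer : integer_valued conf_measure
}.
Arguments conf R {d} S.

Record Cc (R : realType) (T : topologicalType) := MkCc {
  Cc_fun :> T -> R ;
  Cc_continuous : continuous Cc_fun ;
  Cc_support : exists2 K : set T, compact K & forall x, ~ K x -> Cc_fun x = 0
}.

Section conf_structure.
Context (R : realType) (d : measure_display) (S : baseSpaceType d).

Lemma radon_mzero : radon (@mzero d S R).
Proof.
split=> [K _|A _|U _]; first by rewrite /mzero ltry.
- apply/eqP; rewrite eq_le; apply/andP; split.
    by apply: le_ereal_inf_tmp => _ [U _ <-].
  by apply: ereal_inf_lbound; exists setT => //; split => //; exact: openT.
- apply/eqP; rewrite eq_le; apply/andP; split.
    apply: ereal_sup_ubound; exists set0 => //.
    by split => //; exact: compact0.
  by apply: ge_ereal_sup => _ [K _ <-].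
Qed.

Lemma integer_valued_mzero : integer_valued (@mzero d S R).
Proof. by move=> A _; right; exists 0%N. Qed.

HB.instance Definition _ := gen_eqMixin (conf R S).
HB.instance Definition _ := gen_choiceMixin (conf R S).
HB.instance Definition _ :=
  isPointed.Build (conf R S) (Conf radon_mzero integer_valued_mzero).

Definition conf_integral (xi : conf R S) : {ptws Cc R S -> R} :=
  fun f => (\int[xi]_x f x)%R.

(* The vague topology is the coarsest one making every [xi |-> \int f dxi],
   [f] in [C_c(S)], continuous. *)
Definition vague_open : set (set (conf R S)) :=
  @open (initial_topology conf_integral).

HB.instance Definition _ := @isMeasurable.Build (sigma_display vague_open)
  (conf R S) <<s vague_open >> (@sigma_algebra0 _ setT vague_open)
  (@sigma_algebraC _ vague_open) (@sigma_algebra_bigcup _ setT vague_open).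

End conf_structure.

Section correlation.
Context (R : realType) (d : measure_display) (S : baseSpaceType d).
Local Open Scope ereal_scope.

Fixpoint tensor_power (lam : set S -> \bar R) (n : nat) :
    set (n.-tuple S) -> \bar R :=
  match n return set (n.-tuple S) -> \bar R with
  | 0 => \d_[tuple]
  | n'.+1 => pushforward (lam \x @tensor_power lam n')
               (fun z : S * n'.-tuple S => [tuple of z.1 :: z.2])
  end.

Arguments tensor_power lam n : clear implicits.

Definition symmetric_measure n (nu : set (n.-tuple S) -> \bar R) : Prop :=
  forall (s : 'S_n) (A : set (n.-tuple S)), measurable A ->
    nu ((fun x => [tuple tnth x (s i) | i < n]) @^-1` A) = nu A.

(* [L_1^{k_1} x ... x L_m^{k_m}] *)
Definition power_rectangle m (L : 'I_m -> set S) (k : 'I_m -> nat) n :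
    set (n.-tuple S) :=
  [set x | forall i : 'I_n,
     nth set0 (flatten [seq nseq (k j) (L j) | j <- enum 'I_m]) i (tnth x i)].

Arguments power_rectangle {m} L k n.

Definition npoints (xi : conf R S) (A : set S) : nat := Num.truncn (fine (xi A)).

Context (e : measure_display) (Omega : measurableType e).

Definition is_correlation_measure (P : probability Omega R)
    (Xi : {RV P >-> conf R S}) n
    (nu : {measure set (n.-tuple S) -> \bar R}) : Prop :=
  symmetric_measure nu /\
  forall m (L : 'I_m -> set S) (k : 'I_m -> nat),
    (forall j, bounded_borel (L j)) -> trivIset setT L ->
    (\sum_(j < m) k j = n)%N ->
    'E_P[fun w => (\prod_(j < m) npoints (Xi w) (L j) ^_ k j)%N%:R]
    = nu (power_rectangle L k n).

Definition is_correlation_function (P : probability Omega R)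
    (Xi : {RV P >-> conf R S}) (lam : set S -> \bar R) n
    (rho : n.-tuple S -> R) : Prop :=
  [/\ measurable_fun setT rho, forall x, (0 <= rho x)%R &
      exists2 nu : {measure set (n.-tuple S) -> \bar R},
        is_correlation_measure Xi nu &
        forall A, measurable A ->
          nu A = \int[tensor_power lam n]_(x in A) (rho x)%:E].

Definition simple_process (P : probability Omega R)
    (Xi : {RV P >-> conf R S}) : Prop :=
  {ae P, forall w, forall x : S, Xi w [set x] = 0 \/ Xi w [set x] = 1}.

Definition is_DPP (P : probability Omega R) (Xi : {RV P >-> conf R S})
    (K : S -> S -> R[i]) (lam : set S -> \bar R) : Prop :=
  simple_process Xi /\
  forall n, (0 < n)%N ->
    exists2 rho : n.-tuple S -> R, is_correlation_function Xi lam rho &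
      {ae tensor_power lam n, forall x,
        (rho x)%:C = \det (\matrix_(i, j) K (tnth x i) (tnth x j))}.

End correlation.

Arguments tensor_power {R d S} lam n.
Arguments power_rectangle {d S m} L k n.

Section complex_L2.
Context (R : realType) (d : measure_display) (T : measurableType d).

Definition cmeasurable (f : T -> R[i]) : Prop :=
  measurable_fun setT (fun x => complex.Re (f x)) /\
  measurable_fun setT (fun x => complex.Im (f x)).

Definition cintegral (mu : {measure set T -> \bar R}) (D : set T)
    (f : T -> R[i]) : R[i] :=
  (\int[mu]_(x in D) complex.Re (f x))%R +i*
  (\int[mu]_(x in D) complex.Im (f x))%R.

Definition L2norm (mu : {measure set T -> \bar R}) (f : T -> R[i]) : \bar R :=
  Lnorm mu 2%:E (fun x => (Normc.normc (f x))%:E).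

Definition L2 (mu : {measure set T -> \bar R}) : set (T -> R[i]) :=
  [set f | cmeasurable f /\ (L2norm mu f < +oo)%E].

Definition L2inner (mu : {measure set T -> \bar R}) (f g : T -> R[i]) : R[i] :=
  cintegral mu setT (fun x => f x * (g x)^*).

Definition orthonormal_basis (mu : {measure set T -> \bar R})
    (E : set (T -> R[i])) : Prop :=
  [/\ E `<=` L2 mu,
      forall f, E f -> L2inner mu f f = 1,
      forall f g, E f -> E g -> f <> g -> L2inner mu f g = 0 &
      forall f, L2 mu f -> (forall g, E g -> L2inner mu f g = 0) ->
        f = cst 0 %[ae mu]].

Definition projection (D : set T) (f : T -> R[i]) : T -> R[i] :=
  fun x => (\1_D x)%:C * f x.

End complex_L2.

Section operators.
Context (R : realType) (d1 d2 : measure_display).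
Context (T1 : measurableType d1) (T2 : measurableType d2).
Context (mu1 : {measure set T1 -> \bar R}) (mu2 : {measure set T2 -> \bar R}).

(* An operator [L^2(mu1) -> L^2(mu2)] is given by its action on representatives;
   only its values on [L2 mu1], up to a.e. equality, are meaningful. *)
Definition bounded_operator (A : (T1 -> R[i]) -> (T2 -> R[i])) : Prop :=
  [/\ forall f, L2 mu1 f -> L2 mu2 (A f),
      forall f g, L2 mu1 f -> L2 mu1 g ->
        f = g %[ae mu1] -> A f = A g %[ae mu2],
      forall (a : R[i]) f g, L2 mu1 f -> L2 mu1 g ->
        A (fun x => a * f x + g x) = (fun y => a * A f y + A g y) %[ae mu2] &
      exists M : R, forall f, L2 mu1 f ->
        (L2norm mu2 (A f) <= M%:E * L2norm mu1 f)%E].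

Definition kernel_orthogonal (A : (T1 -> R[i]) -> (T2 -> R[i])) :
    set (T1 -> R[i]) :=
  [set f | L2 mu1 f /\
    forall g, L2 mu1 g -> A g = cst 0 %[ae mu2] -> L2inner mu1 f g = 0].

Definition partial_isometry (A : (T1 -> R[i]) -> (T2 -> R[i])) : Prop :=
  bounded_operator A /\
  forall f, kernel_orthogonal A f -> L2norm mu2 (A f) = L2norm mu1 f.

Definition hilbert_schmidt (A : (T1 -> R[i]) -> (T2 -> R[i])) : Prop :=
  bounded_operator A /\
  exists2 E, orthonormal_basis mu1 E &
    (\esum_(f in E) L2norm mu2 (A f) ^+ 2 < +oo)%E.

Definition is_adjoint (A : (T1 -> R[i]) -> (T2 -> R[i]))
    (B : (T2 -> R[i]) -> (T1 -> R[i])) : Prop :=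
  (forall g, L2 mu2 g -> L2 mu1 (B g)) /\
  forall f g, L2 mu1 f -> L2 mu2 g -> L2inner mu2 (A f) g = L2inner mu1 f (B g).

End operators.

Section kernels.
Context (R : realType) (d1 d2 : measure_display).
Context (S1 : baseSpaceType d1) (S2 : baseSpaceType d2).
Context (lam1 : {measure set S1 -> \bar R}) (lam2 : {measure set S2 -> \bar R}).

Definition locally_hilbert_schmidt (A : (S1 -> R[i]) -> (S2 -> R[i])) : Prop :=
  bounded_operator lam1 lam2 A /\
  forall K : set S1, compact K ->
    hilbert_schmidt lam1 lam2 (fun f => A (projection K f)).

Definition vanishes_outside_compact (T : topologicalType) (f : T -> R[i]) :=
  exists2 K : set T, compact K & forall x, ~ K x -> f x = 0.

(* The formulas for general [f] and [g], by L^2-limits of truncations to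
   compact sets, follow from the two below and boundedness. *)
Definition is_integral_kernel (A : (S1 -> R[i]) -> (S2 -> R[i]))
    (Astar : (S2 -> R[i]) -> (S1 -> R[i])) (W : S2 -> S1 -> R[i]) : Prop :=
  [/\ cmeasurable (fun z : S2 * S1 => W z.1 z.2),
      forall K : set S1, compact K ->
        (\int[lam1]_(x in K) (L2norm lam2 (fun y => W y x) ^+ 2) < +oo)%E,
      forall K : set S2, compact K ->
        (\int[lam2]_(y in K) (L2norm lam1 (fun x => W y x) ^+ 2) < +oo)%E,
      forall f, L2 lam1 f -> vanishes_outside_compact f ->
        {ae lam2, forall y,
          A f y = cintegral lam1 setT (fun x => W y x * f x)} &
      forall g, L2 lam2 g -> vanishes_outside_compact g ->
        {ae lam1, forall x,
          Astar g x = cintegral lam2 setT (fun y => (W y x)^* * g y)}].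

Definition kernel1 (W : S2 -> S1 -> R[i]) (D : set S2) (x x' : S1) : R[i] :=
  cintegral lam2 D (fun y => (W y x)^* * W y x').

Definition kernel2 (W : S2 -> S1 -> R[i]) (D : set S1) (y y' : S2) : R[i] :=
  cintegral lam1 D (fun x => W y x * (W y' x)^*).

End kernels.

(* Main.v *)
From HB Require Import structures.
Require Import Defs.
From mathcomp Require Import all_boot all_order all_algebra all_fingroup.
From mathcomp Require Import all_classical all_reals all_analysis.
From mathcomp Require Import measurable_realfun complex.
From mathcomp Require Import ring lra.

(** The number of points of a determinantal process in a set is determined by its
    factorial moments, and these are the same on both sides of the duality.

    Let [A] and [B] be the two sets. The correlation kernel of the first process is
    the Gram matrix of the functions [y |-> W y x] restricted to [B]. By Andreief's
    identity ([andreief]) its determinant at [x_1, ..., x_n] is [1 / n!] times the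
    integral over [B^n] of the squared modulus of the determinant of the matrix
    [W y_i x_j]. Integrating over [A^n] gives the [n]-th factorial moment of the number
    of points in [A] ([determinantal_moment]). This expression is symmetric: by
    Tonelli's theorem it is also the [n]-th factorial moment of the number of points in
    [B] of the second process ([determinantal_moment_symm]).

    Hadamard's inequality ([hadamard]) bounds the [n]-th moment by the [n]-th power of
    the first one, call it [c]. If [c] is finite, the inclusion-exclusion series
    that expresses the probability of having exactly [m] points through the factorial
    moments converges, with Bonferroni's inequality ([bonferroni]) bounding the
    remainder by [c^(m+k) / (m! k!)]; so the moments determine the law. If [c] is
    infinite, the counts in an increasing sequence of bounded windows have variances
    at most their means, by the case [n = 2], and means growing to infinity; by
    Chebyshev's inequality both counts are almost surely infinite. The lemma
    [exhausts_unique] covers both cases. The sets [A] and [B] need not be bounded, so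
    moments are computed in the windows of an exhaustion by relatively compact open
    sets; this requires that the counts be random variables, which is deduced from the
    definition of the vague topology by inner regularity and Urysohn's lemma
    ([measurable_npoints]). *)

Set Implicit Arguments.
Unset Strict Implicit.
Unset Printing Implicit Defensive.

Import Order.TTheory GRing.Theory Num.Theory.
Import numFieldNormedType.Exports.

Local Open Scope classical_set_scope.
Local Open Scope complex_scope.
Local Open Scope ring_scope.

(** * Hadamard's inequality for positive semidefinite matrices *)

Section hadamard.
Context (C : numClosedFieldType).

(** A matrix is positive semidefinite when it is Hermitian and its form takes
    nonnegative values, in the order of [C] (so real and nonnegative). *)
Definition psd n (M : 'M[C]_n) : Prop :=
  (forall i j, M j i = (M i j)^*) /\
  forall u : 'I_n -> C, 0 <= \sum_i \sum_j (u i)^* * M i j * u j.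

Lemma sum_delta2 n (F : 'I_n -> 'I_n -> C) i :
  \sum_j \sum_k (j == i)%:R^* * F j k * (k == i)%:R = F i i.
Proof.
rewrite (bigD1 i)//= [X in _ + X]big1 ?addr0; last first.
  by move=> j /negPf ->; rewrite big1// => k _; rewrite conjC0 !mul0r.
rewrite (bigD1 i)//= [X in _ + X]big1 ?addr0; last first.
  by move=> j /negPf ->; rewrite mulr0.
by rewrite eqxx conjC1 mul1r mulr1.
Qed.

Lemma psd_diag_ge0 n (M : 'M[C]_n) i : psd M -> 0 <= M i i.
Proof. by move=> [_ /(_ (fun j => (j == i)%:R))]; rewrite sum_delta2. Qed.

(** The form of [M] at the vector [(s, v)], expanded along the first coordinate. *)
Lemma psd_form_split n (M : 'M[C]_(1 + n)) (s : C) (v : 'I_n -> C) :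
  psd M ->
  0 <= s^* * M ord0 ord0 * s + s^* * (\sum_j M ord0 (lift ord0 j) * v j)
     + (\sum_j M ord0 (lift ord0 j) * v j)^* * s
     + \sum_i \sum_j (v i)^* * M (lift ord0 i) (lift ord0 j) * v j.
Proof.
move=> [hM /(_ (fun i => if unlift ord0 i is Some j then v j else s))].
rewrite !(@big_ord_recl _ _ _ n) unlift_none.
rewrite (eq_bigr (fun j => s^* * (M ord0 (lift ord0 j) * v j))); last first.
  by move=> j _; rewrite liftK mulrA.
rewrite -mulr_sumr.
under [X in _ + X]eq_bigr => i _ do rewrite big_ord_recl unlift_none liftK.
rewrite big_split/= -mulr_suml addrA.
rewrite rmorph_sum/=.
under [X in _ + X * s + _]eq_bigr => i _.
  rewrite rmorphM/= -(hM ord0 (lift ord0 i)) mulrC.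
over.
by under [X in _ + X]eq_bigr => i _ do under eq_bigr => j _ do rewrite liftK.
Qed.

(** A zero on the diagonal forces a zero row: were an entry [b] of the row nonzero, the
    form at [(- t * b, e_j)] would equal [-1] for a suitable real [t]. *)
Lemma psd_row0 n (M : 'M[C]_(1 + n)) :
  psd M -> M ord0 ord0 = 0 -> forall j, M ord0 (lift ord0 j) = 0.
Proof.
move=> pM M00 j; apply/eqP; apply/negPn/negP => Mj0.
set b := M ord0 (lift ord0 j) in Mj0 *.
set d := M (lift ord0 j) (lift ord0 j).
have b2 : b * b^* != 0 by rewrite mulf_neq0// conjC_eq0.
have dr : d^* = d by case: pM => hM _; rewrite /d -hM.
(* With this [t] the form below is [- 2 t |b|^2 + d = -1]. *)
pose t := (d + 1) / (2 * (b * b^*)).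
have tr : t^* = t.
  rewrite /t fmorph_div/= !rmorphM/= conjCK rmorphD/= dr conjC1.
  by rewrite conjC_nat (mulrC b).
have := psd_form_split (- t * b) (fun k => (k == j)%:R) pM.
have sE : \sum_k M ord0 (lift ord0 k) * (k == j)%:R = b.
  rewrite (bigD1 j)//= eqxx mulr1 big1 ?addr0// => k /negPf ->.
  by rewrite mulr0.
rewrite M00 mulr0 mul0r add0r sE.
rewrite (sum_delta2 (fun i k => M (lift ord0 i) (lift ord0 k))).
rewrite -/d rmorphM/= rmorphN/= tr.
have -> : - t * b^* * b + b^* * (- t * b) + d = -1.
  rewrite (_ : _ + _ = - (t * (2 * (b * b^*))) + d); last by ring.
  rewrite /t divfK; last by rewrite mulf_neq0// pnatr_eq0.
  by rewrite opprD addrAC addNr add0r.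
by rewrite ler0N1.
Qed.

(** The Schur complement of the top left entry; it is meaningful when that entry
    is nonzero. *)
Definition schur n (M : 'M[C]_(1 + n)) : 'M[C]_n :=
  \matrix_(i, j) (M (lift ord0 i) (lift ord0 j)
     - M (lift ord0 i) ord0 * M ord0 (lift ord0 j) / M ord0 ord0).

Lemma det_schur n (M : 'M[C]_(1 + n)) : M ord0 ord0 != 0 ->
  \det M = M ord0 ord0 * \det (schur M).
Proof.
move=> M0.
pose L : 'M[C]_(1 + n) :=
  block_mx 1%:M 0 ((M ord0 ord0)^-1 *: dlsubmx M) 1%:M.
pose U : 'M[C]_(1 + n) := block_mx (ulsubmx M) (ursubmx M) 0 (schur M).
have l0 : lshift n ord0 = ord0 :> 'I_(1 + n) by apply: val_inj.
have rl i : rshift 1 i = lift ord0 i :> 'I_(1 + n) by apply: val_inj.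
have ME : M = L *m U.
  rewrite /L /U mulmx_block !mul1mx !mul0mx !addr0.
  rewrite -[LHS]submxK; congr block_mx.
  - apply/matrixP => i j; rewrite !mxE big_ord1 !mxE !ord1 !l0.
    by rewrite mulrAC mulVf// mul1r.
  - apply/matrixP => i j; rewrite !mxE big_ord1 !mxE !l0 !rl.
    by ring.
rewrite [in LHS]ME det_mulmx det_lblock det_ublock !det1 !mul1r; congr (_ * _).
by rewrite det_mx11 !mxE l0.
Qed.

Lemma psd_schur n (M : 'M[C]_(1 + n)) : M ord0 ord0 != 0 ->
  psd M -> psd (schur M).
Proof.
move=> M0 pM; have [hM _] := pM; split=> [i j|v].
  by rewrite !mxE rmorphB/= fmorph_div/= rmorphM/= -!hM; congr (_ - _ / _);
    rewrite mulrC.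
have aR : (M ord0 ord0)^* = M ord0 ord0 by rewrite -hM.
set a := M ord0 ord0 in M0 aR *.
set L := \sum_j M ord0 (lift ord0 j) * v j.
(* The minimum over the first coordinate is attained at [- L / a]. *)
have /le_trans := psd_form_split (- L / a) v pM; apply.
rewrite -/a -/L.
have -> : \sum_i \sum_j (v i)^* * schur M i j * v j =
    \sum_i \sum_j (v i)^* * M (lift ord0 i) (lift ord0 j) * v j - L^* * L / a.
  rewrite {1}/L rmorph_sum/= -mulrA mulr_suml -sumrB; apply: eq_bigr => i _.
  rewrite /L mulr_suml mulr_sumr -sumrB.
  apply: eq_bigr => j _; rewrite !mxE rmorphM/= -(hM ord0 (lift ord0 i)) -/a.
  by ring.
have -> : (- L / a)^* = - L^* / a by rewrite fmorph_div/= rmorphN/= aR.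
rewrite -subr_ge0 (_ : _ - _ = 0)//.
by field.
Qed.

(** Induction on the size: the Schur complement is again positive semidefinite and
    its diagonal entries are at most those of [M]. If the top left entry vanishes,
    so does the first row, hence the determinant. *)
Lemma hadamard n (M : 'M[C]_n) : psd M -> \det M <= \prod_i M i i.
Proof.
elim: n M => [|n IH] M pM; first by rewrite det_mx00 big_ord0.
rewrite big_ord_recl; have [M0|M0] := eqVneq (M ord0 ord0) 0.
  rewrite M0 mul0r (expand_det_row _ ord0) big1// => j _.
  case: (unliftP ord0 j) => [k ->|->]; last by rewrite M0 mul0r.
  by rewrite (psd_row0 (n := n) pM M0) mul0r.
rewrite (det_schur (n := n) M0) ler_wpM2l ?psd_diag_ge0//.
have pS := psd_schur (n := n) M0 pM.
apply: (le_trans (IH _ pS)); apply: ler_prod => i _.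
rewrite psd_diag_ge0//= mxE lerBlDr lerDl.
have [hM _] := pM; rewrite (hM ord0 (lift ord0 i)).
by rewrite divr_ge0 ?psd_diag_ge0// mulrC mul_conjC_ge0.
Qed.

End hadamard.

(** * Integration of real and complex functions *)

Lemma measure_integral_indic (R : realType) d' (T : measurableType d')
    (mu : {measure set T -> \bar R}) (A : set T) : measurable A ->
  mu A = (\int[mu]_x (\1_A x)%:E)%E.
Proof. by move=> mA; rewrite integral_indic// setIT. Qed.

Section Rintegral_sum.
Context (R : realType) d (T : measurableType d)
  (mu : {measure set T -> \bar R}).

Lemma integrable_EFin_sum (I : Type) (r : seq I) (F : I -> T -> R) :
  (forall i, mu.-integrable setT (EFin \o F i)) ->
  mu.-integrable setT (EFin \o (fun x => \sum_(i <- r) F i x)).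
Proof.
move=> iF; apply: (eq_integrable measurableT
  (fun x => \sum_(i <- r) (F i x)%:E)%E).
  by move=> x _ /=; rewrite sumEFin.
by apply: integrable_sum => // i _; exact: iF.
Qed.

Lemma Rintegral_sum (I : Type) (r : seq I) (F : I -> T -> R) :
  (forall i, mu.-integrable setT (EFin \o F i)) ->
  (\int[mu]_x \sum_(i <- r) F i x)%R = \sum_(i <- r) (\int[mu]_x F i x)%R.
Proof.
move=> iF; elim: r => [|i r IH].
  rewrite big_nil; under eq_Rintegral do rewrite big_nil.
  by rewrite /Rintegral integral0.
rewrite big_cons -IH -RintegralD//; last exact: integrable_EFin_sum.
by apply: eq_Rintegral => x _; rewrite big_cons.
Qed.

Lemma integrable_EFinZl (k : R) (f : T -> R) :
  mu.-integrable setT (EFin \o f) ->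
  mu.-integrable setT (EFin \o (fun x => k * f x)).
Proof. by move=> /(integrableZl measurableT k). Qed.

Lemma integrable_EFinB (f g : T -> R) : mu.-integrable setT (EFin \o f) ->
  mu.-integrable setT (EFin \o g) ->
  mu.-integrable setT (EFin \o (fun x => f x - g x)).
Proof. by move=> fi /(integrableB measurableT fi). Qed.

Lemma integrable_EFinD (f g : T -> R) : mu.-integrable setT (EFin \o f) ->
  mu.-integrable setT (EFin \o g) ->
  mu.-integrable setT (EFin \o (fun x => f x + g x)).
Proof. by move=> fi /(integrableD measurableT fi). Qed.

End Rintegral_sum.

Section complex_integral.
Context (R : realType) d (T : measurableType d)
  (mu : {measure set T -> \bar R}).

(** A complex function is integrable when its real and imaginary parts are. *)
Definition cintegrable (f : T -> R[i]) : Prop :=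
  mu.-integrable setT (EFin \o (fun x => complex.Re (f x))) /\
  mu.-integrable setT (EFin \o (fun x => complex.Im (f x))).

Lemma ReM (z w : R[i]) :
  complex.Re (z * w) = complex.Re z * complex.Re w - complex.Im z *
    complex.Im w.
Proof. by case: z w => [a b] [c e]. Qed.

Lemma ImM (z w : R[i]) :
  complex.Im (z * w) = complex.Re z * complex.Im w + complex.Im z *
    complex.Re w.
Proof. by case: z w => [a b] [c e]. Qed.

Lemma ReD (z w : R[i]) : complex.Re (z + w) = complex.Re z + complex.Re w.
Proof. by case: z w => [a b] [c e]. Qed.

Lemma ImD (z w : R[i]) : complex.Im (z + w) = complex.Im z + complex.Im w.
Proof. by case: z w => [a b] [c e]. Qed.

Lemma eq_cintegral (f g : T -> R[i]) : f =1 g ->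
  cintegral mu setT f = cintegral mu setT g.
Proof. by move=> /funext ->. Qed.

Lemma cintegrableZl c (f : T -> R[i]) : cintegrable f ->
  cintegrable (fun x => c * f x).
Proof.
move=> [fR fI]; split.
- under eq_fun do rewrite ReM.
  by apply: integrable_EFinB; exact: integrable_EFinZl.
- under eq_fun do rewrite ImM.
  by apply: integrable_EFinD; exact: integrable_EFinZl.
Qed.

Lemma cintegralZl c (f : T -> R[i]) : cintegrable f ->
  cintegral mu setT (fun x => c * f x) = c * cintegral mu setT f.
Proof.
move=> [fR fI]; apply/eqP; rewrite eq_complex ReM ImM /cintegral/=.
under eq_Rintegral do rewrite ReM.
under [X in _ && (X == _)]eq_Rintegral do rewrite ImM.
rewrite RintegralB ?RintegralD//; try exact: integrable_EFinZl.
by rewrite !RintegralZl// !eqxx.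
Qed.

Lemma cintegrable_sum (I : Type) (r : seq I) (F : I -> T -> R[i]) :
  (forall i, cintegrable (F i)) -> cintegrable (fun x => \sum_(i <- r) F i x).
Proof.
move=> iF; split.
- have := integrable_EFin_sum r (fun i => (iF i).1); congr (_.-integrable _ _).
  apply/funext => x /=; congr EFin.
  by elim/big_rec2: _ => // i y z _ ->; rewrite ReD.
- have := integrable_EFin_sum r (fun i => (iF i).2); congr (_.-integrable _ _).
  apply/funext => x /=; congr EFin.
  by elim/big_rec2: _ => // i y z _ ->; rewrite ImD.
Qed.

Lemma cintegral_sum (I : Type) (r : seq I) (F : I -> T -> R[i]) :
  (forall i, cintegrable (F i)) ->
  cintegral mu setT (fun x => \sum_(i <- r) F i x) =
  \sum_(i <- r) cintegral mu setT (F i).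
Proof.
move=> iF; apply/eqP; rewrite eq_complex /cintegral/=; apply/andP; split;
  apply/eqP.
- transitivity (\sum_(i <- r) (\int[mu]_x complex.Re (F i x))%R).
    rewrite -Rintegral_sum; last by move=> i; have [] := iF i.
    apply: eq_Rintegral => x _.
    by elim/big_rec2: _ => // i y z _ <-; rewrite ReD.
  by elim/big_rec2: _ => // i y z _ ->; rewrite ReD.
- transitivity (\sum_(i <- r) (\int[mu]_x complex.Im (F i x))%R).
    rewrite -Rintegral_sum; last by move=> i; have [] := iF i.
    apply: eq_Rintegral => x _.
    by elim/big_rec2: _ => // i y z _ <-; rewrite ImD.
  by elim/big_rec2: _ => // i y z _ ->; rewrite ImD.
Qed.

End complex_integral.

Section product_integral.
Context (R : realType) d1 d2 (T1 : measurableType d1) (T2 : measurableType d2).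
Variables (m1 : {sigma_finite_measure set T1 -> \bar R})
  (m2 : {sigma_finite_measure set T2 -> \bar R}).

Lemma integrable_prod_mul (f : T1 -> R) (g : T2 -> R) :
  m1.-integrable setT (EFin \o f) -> m2.-integrable setT (EFin \o g) ->
  (m1 \x m2)%E.-integrable setT (EFin \o (fun z => f z.1 * g z.2)).
Proof.
move=> fi gi.
have mf : measurable_fun setT f by apply/measurable_EFinP;
  exact: measurable_int fi.
have mg : measurable_fun setT g by apply/measurable_EFinP;
  exact: measurable_int gi.
apply/integrable12ltyP.
  apply/measurable_EFinP; apply: measurable_funM; exact: measurableT_comp.
have /integrableP[_ fl] := fi; have /integrableP[_ gl] := gi.
under eq_integral => x _.
  under eq_integral do rewrite /= normrM EFinM.
  rewrite ge0_integralZl//; last first.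
    by apply/measurable_EFinP; exact: measurableT_comp.
  over.
rewrite ge0_integralZr//.
- by rewrite lte_mul_pinfty//; [exact: integral_ge0|rewrite ge0_fin_numE//;
  exact: integral_ge0].
- by apply/measurable_EFinP; exact: measurableT_comp.
- exact: integral_ge0.
Qed.

Lemma Rintegral_prod_mul (f : T1 -> R) (g : T2 -> R) :
  m1.-integrable setT (EFin \o f) -> m2.-integrable setT (EFin \o g) ->
  (\int[(m1 \x m2)%E]_z (f z.1 * g z.2))%R =
  (\int[m1]_x f x)%R * (\int[m2]_y g y)%R.
Proof.
move=> fi gi; have fgi := integrable_prod_mul fi gi.
rewrite /Rintegral -integral12_prod_meas1// /fubini_F/=.
under eq_integral do under eq_integral do rewrite EFinM.
have gf : (\int[m2]_y (g y)%:E)%E \is a fin_num by exact: integrable_fin_num.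
have ff : (\int[m1]_y (f y)%:E)%E \is a fin_num by exact: integrable_fin_num.
under eq_integral do rewrite integralZl//.
rewrite -fineM// -[X in (_ * X)%E]fineK//.
under eq_integral do rewrite -[X in (_ * X)%E]fineK//.
by rewrite integralZr.
Qed.

End product_integral.

(** * Powers of a sigma-finite measure *)

Section sigma_finite_pack.
Context d (T : measurableType d) (R : realType)
  (mu : {measure set T -> \bar R}).
Hypothesis smu : sigma_finite setT mu.

(** A sigma-finite measure, repackaged with its proof so that Fubini's theorem
    applies to it. *)
Definition sigma_finite_copy : set T -> \bar R := let _ := smu in mu.

HB.instance Definition _ := Measure.copy sigma_finite_copy mu.
HB.instance Definition _ :=
  Measure_isSigmaFinite.Build _ _ _ sigma_finite_copy smu.

Lemma sigma_finite_measureP :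
  exists m : {sigma_finite_measure set T -> \bar R},
    mu = m :> {measure set T -> \bar R}.
Proof. by exists sigma_finite_copy; exact: eq_measure. Qed.

End sigma_finite_pack.

Section pushforward_sigma_finite.
Context d1 d2 (T1 : measurableType d1) (T2 : measurableType d2) (R : realType).
Variables (m : {measure set T1 -> \bar R}) (f : T1 -> T2) (g : T2 -> T1).
Hypotheses (sm : sigma_finite setT m) (mf : measurable_fun setT f)
  (mg : measurable_fun setT g)
  (fK : cancel f g).

Lemma sigma_finite_pushforward : sigma_finite setT (pushforward m f).
Proof.
have [F FT mF] := sm.
exists (fun k => g @^-1` F k).
  by rewrite -preimage_bigcup -FT preimage_setT.
move=> k; have [mFk Fk] := mF k; split.
  by rewrite -[X in measurable X]setTI; exact: mg.
rewrite /pushforward (_ : f @^-1` _ = F k)//.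
by apply/seteqP; split => x /=; rewrite fK.
Qed.

(** The image of a sigma-finite measure by a map with a measurable left inverse is
    sigma-finite. *)
Lemma pushforward_sigma_finiteP :
  exists n : {sigma_finite_measure set T2 -> \bar R},
    pushforward m f = n :> (set T2 -> \bar R).
Proof.
have [n nE] := sigma_finite_measureP
  (mu := measure_function_pushforward__canonical__measure_function_Measure m mf)
  sigma_finite_pushforward.
by exists n; exact: (congr1 (fun M : {measure set T2 -> \bar R} =>
  M : set T2 -> \bar R) nE).
Qed.

End pushforward_sigma_finite.

(** Products of the members of two increasing exhaustions cover the product space; the
    exhaustions must be increasing so that two indices can be merged into one. *)
Lemma product_sigma_finite d1 d2 (T1 : measurableType d1)
  (T2 : measurableType d2)
    (R : realType) (m1 : {sigma_finite_measure set T1 -> \bar R})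
    (m2 : {sigma_finite_measure set T2 -> \bar R}) :
  sigma_finite setT (m1 \x m2)%E.
Proof.
have /sigma_finiteP[F [FT ndF mF]] := sigma_finiteT m1.
have /sigma_finiteP[G [GT ndG mG]] := sigma_finiteT m2.
exists (fun k => F k `*` G k).
  apply/esym/seteqP; split => // -[x y] _.
  have [i _ Fx] : (\bigcup_i F i) x by rewrite -FT.
  have [j _ Gy] : (\bigcup_j G j) y by rewrite -GT.
  exists (maxn i j) => //; split => /=.
    by have /subsetPset := ndF _ _ (leq_maxl i j); apply.
  by have /subsetPset := ndG _ _ (leq_maxr i j); apply.
move=> k; have [mFk Fk] := mF k; have [mGk Gk] := mG k.
split; first exact: measurableX.
by rewrite product_measure1E// lte_mul_pinfty// ge0_fin_numE.
Qed.

Lemma emeasurable_prod d (T : measurableType d) (R : realType) (I : Type)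
    (r : seq I) (f : I -> T -> \bar R) :
  (forall i, measurable_fun setT (f i)) ->
  measurable_fun setT (fun x => \prod_(i <- r) f i x)%E.
Proof.
move=> mf; elim: r => [|i r IH].
  by under eq_fun do rewrite big_nil; exact: measurable_cst.
by under eq_fun do rewrite big_cons; exact: emeasurable_funM.
Qed.

Section tensor_power_measure.
Context (R : realType) (d : measure_display) (S : baseSpaceType d).
Variable lam : {sigma_finite_measure set S -> \bar R}.

(** The identification of [S * S^n] with [S^(n+1)] through which [tensor_power] is
    defined, and its inverse. *)
Definition tcons n (z : S * n.-tuple S) : n.+1.-tuple S :=
  [tuple of z.1 :: z.2].
Definition tuncons n (t : n.+1.-tuple S) : S * n.-tuple S :=
  (thead t, [tuple of behead t]).

Lemma tconsK n : cancel (@tcons n) (@tuncons n).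
Proof.
by move=> [x t]; rewrite /tuncons theadE; congr pair; apply: val_inj.
Qed.

Lemma measurable_tcons n : measurable_fun setT (@tcons n).
Proof. exact: measurable_cons. Qed.

Lemma measurable_tuncons n : measurable_fun setT (@tuncons n).
Proof.
apply/measurable_fun_pairP; split => /=; last exact: measurable_behead.
exact: measurable_tnth.
Qed.

Lemma tensor_powerP n : exists m : {sigma_finite_measure set (n.-tuple S) ->
  \bar R},
  tensor_power lam n = m :> (set (n.-tuple S) -> \bar R).
Proof.
elim: n => [|n [m mE]]; first by exists (\d_[tuple]).
have [p pE] := @pushforward_sigma_finiteP _ _ (S * n.-tuple S)%type _ R
  (lam \x m)%E _ _ (product_sigma_finite lam m) (@measurable_tcons n)
    (@measurable_tuncons n) (@tconsK n).
by exists p; rewrite -pE /= mE.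
Qed.

Lemma tensor_power_measure0 n : tensor_power lam n set0 = 0%E.
Proof. by have [m ->] := tensor_powerP n; exact: measure0. Qed.

Lemma tensor_power_ge0 n A : (0 <= tensor_power lam n A)%E.
Proof. by have [m ->] := tensor_powerP n; exact: measure_ge0. Qed.

Lemma tensor_power_sigma_additive n : semi_sigma_additive (tensor_power lam n).
Proof.
by have [m ->] := tensor_powerP n; exact: measure_semi_sigma_additive.
Qed.

HB.instance Definition _ n := isMeasure.Build _ _ _ (tensor_power lam n)
  (tensor_power_measure0 n) (@tensor_power_ge0 n)
    (@tensor_power_sigma_additive n).

Lemma tensor_power_sigma_finite n : sigma_finite setT (tensor_power lam n).
Proof. by have [m ->] := tensor_powerP n; exact: sigma_finiteT. Qed.

HB.instance Definition _ n := Measure_isSigmaFinite.Build _ _ _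
  (tensor_power lam n)
  (tensor_power_sigma_finite n).

Lemma measurable_tensor_prod n (F : 'I_n -> S -> \bar R) :
  (forall i, measurable_fun setT (F i)) ->
  measurable_fun setT (fun x : n.-tuple S => \prod_(i < n) F i (tnth x i))%E.
Proof.
move=> mF; apply: emeasurable_prod => i.
exact: (measurableT_comp (mF i) (measurable_tnth i)).
Qed.

Lemma ge0_tensor_integralS n (f : n.+1.-tuple S -> \bar R) :
  measurable_fun setT f -> (forall x, 0 <= f x)%E ->
  (\int[tensor_power lam n.+1]_x f x =
   \int[lam]_x \int[tensor_power lam n]_t f (tcons (x, t)))%E.
Proof.
move=> mf f0.
transitivity (\int[(lam \x tensor_power lam n)%E]_z (f \o @tcons n) z)%E.
  rewrite -(@ge0_integral_pushforward _ _ _ _ _ _ (@measurable_tcons n) _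
    setT)//.
rewrite fubini_tonelli1//; last by move=> z; exact: f0.
by apply: measurableT_comp => //; exact: measurable_tcons.
Qed.

Lemma tnth_tcons0 n x (t : n.-tuple S) : tnth (tcons (x, t)) ord0 = x.
Proof. exact: tnth0. Qed.

Lemma tnth_tconsS n x (t : n.-tuple S) i : tnth (tcons (x, t)) (lift ord0 i) =
  tnth t i.
Proof. exact: tnthS. Qed.

(** Tonelli for a product of functions of one coordinate each. *)
Lemma ge0_tensor_integral_prod n (F : 'I_n -> S -> \bar R) :
  (forall i, measurable_fun setT (F i)) -> (forall i x, 0 <= F i x)%E ->
  (\int[tensor_power lam n]_x \prod_(i < n) F i (tnth x i) =
   \prod_(i < n) \int[lam]_x F i x)%E.
Proof.
elim: n F => [|n IH] F mF F0.
  rewrite big_ord0; under eq_integral do rewrite big_ord0.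
  by rewrite integral_cst// mul1e/= diracT.
have mP := measurable_tensor_prod mF.
rewrite ge0_tensor_integralS//; last by move=> x; exact: prode_ge0.
have step x : (\int[tensor_power lam n]_t \prod_(i < n.+1) F i
  (tnth (tcons (x, t)) i)
    = F ord0 x * \prod_(i < n) \int[lam]_x F (lift ord0 i) x)%E.
  rewrite -(IH (fun i => F (lift ord0 i)))//.
  rewrite -ge0_integralZl//; last 2 first.
    by apply: (measurable_tensor_prod (F := fun i => F (lift ord0 i))) => i.
    by move=> t _; exact: prode_ge0.
  apply: eq_integral => t _; rewrite big_ord_recl tnth_tcons0.
  by under eq_bigr do rewrite tnth_tconsS.
under eq_integral do rewrite step.
rewrite ge0_integralZr//; last by apply: prode_ge0 => i _; exact: integral_ge0.
by rewrite big_ord_recl.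
Qed.

Lemma tensor_power1_integral (f : S -> \bar R) : measurable_fun setT f ->
  (forall x, 0 <= f x)%E ->
  (\int[tensor_power lam 1]_x f (tnth x ord0) = \int[lam]_x f x)%E.
Proof.
move=> mf f0.
have := ge0_tensor_integral_prod (F := fun _ : 'I_1 => f) (fun _ => mf)
  (fun _ => f0).
by rewrite big_ord1; under eq_integral do rewrite big_ord1.
Qed.

(** Almost every tuple avoids a given null set in all its coordinates. *)
Lemma tensor_power_coord_null n (Z : set S) : measurable Z -> lam Z = 0%E ->
  (tensor_power lam n).-negligible [set x | exists i, Z (tnth x i)].
Proof.
move=> mZ Z0.
have -> : [set x : n.-tuple S | exists i, Z (tnth x i)] =
    \big[setU/set0]_(i < n) [set x | Z (tnth x i)].
  rewrite -bigcup_seq; apply/seteqP; split => x /=.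
    by move=> [i Zi]; exists i => //=; rewrite mem_index_enum.
  by move=> [i _ Zi]; exists i.
elim/big_ind: _ => [|A B|i _].
- exact: negligible_set0.
- exact: negligibleU.
have mZi : measurable [set x : n.-tuple S | Z (tnth x i)].
  by rewrite -[X in measurable X]setTI;
    exact: (measurable_tnth i measurableT mZ).
apply/negligibleP => //.
apply: (etrans (measure_integral_indic (tensor_power lam n) mZi)).
transitivity (\int[tensor_power lam n]_x \prod_(j < n)
    (if j == i then (\1_Z (tnth x j))%:E else 1))%E.
  apply: eq_integral => x _; rewrite (bigD1 i)//= eqxx big1 ?mule1//.
  by move=> j /negPf ->.
rewrite (ge0_tensor_integral_prod (F := fun j x => if j == i then (\1_Z x)%:E
  else 1%E)).
- have IZ : (\int[lam]_x (\1_Z x)%:E = 0)%E.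
    by rewrite -[RHS]Z0; exact/esym/(measure_integral_indic lam mZ).
  by rewrite (bigD1 i)//= eqxx IZ mul0e.
- move=> j; case: (j == i); last exact: measurable_cst.
  exact/measurable_EFinP/measurable_indic.
- by move=> j x; case: (j == i) => //; rewrite lee_fin.
Qed.
End tensor_power_measure.

Section tensor_complex_integral.
Context (R : realType) (d : measure_display) (S : baseSpaceType d).
Variable lam : {sigma_finite_measure set S -> \bar R}.

Lemma tunconsK n : cancel (@tuncons d S n) (@tcons d S n).
Proof. by move=> t; rewrite [RHS]tuple_eta; apply: val_inj. Qed.

Lemma tensor_integrableS n (h : n.+1.-tuple S -> R) :
  (lam \x tensor_power lam n)%E.-integrable setT
    (EFin \o (h \o @tcons d S n)) ->
  (tensor_power lam n.+1).-integrable setT (EFin \o h) /\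
  (\int[tensor_power lam n.+1]_x h x)%R =
  (\int[(lam \x tensor_power lam n)%E]_z h (tcons z))%R.
Proof.
move=> hi; have mh : measurable_fun setT (EFin \o h).
  have := measurableT_comp (measurable_int _ hi) (@measurable_tuncons d S n).
  congr measurable_fun; apply/funext => t /=; congr (h _)%:E; exact: tunconsK.
split.
  exact: (integrable_pushforward (@measurable_tcons d S n) mh hi).
rewrite /Rintegral; congr fine.
exact: (integral_pushforward (@measurable_tcons d S n) mh hi).
Qed.

(** Fubini for a product of integrable complex functions of one coordinate each. *)
Lemma tensor_cintegral_prod n (F : 'I_n -> S -> R[i]) :
  (forall i, cintegrable lam (F i)) ->
  cintegrable (tensor_power lam n) (fun x => \prod_(i < n) F i (tnth x i)) /\
  cintegral (tensor_power lam n) setT (fun x => \prod_(i < n) F i (tnth x i)) =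
  \prod_(i < n) cintegral lam setT (F i).
Proof.
elim: n F => [|n IH] F iF.
  have E1 : (fun x : 0.-tuple S => \prod_(i < 0) F i (tnth x i)) = cst 1.
    by apply/funext => x; rewrite big_ord0.
  rewrite E1 big_ord0; split; first split.
  - exact: (finite_measure_integrable_cst (\d_[tuple]) 1).
  - exact: (finite_measure_integrable_cst (\d_[tuple]) 0).
  have D1 : (tensor_power lam 0 setT = 1)%E by exact: diracT.
  apply/eqP; rewrite eq_complex; apply/andP; split; apply/eqP.
    transitivity (1 * fine (tensor_power lam 0 setT)).
      exact: Rintegral_cst.
    by rewrite D1 mulr1.
  transitivity (0 * fine (tensor_power lam 0 setT)).
    exact: Rintegral_cst.
  by rewrite D1 mulr1.
pose G (t : n.-tuple S) := \prod_(i < n) F (lift ord0 i) (tnth t i).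
have [[GR GI] GE] := IH (fun i => F (lift ord0 i)) (fun i => iF _).
have [FR FI] := iF ord0.
have E1 z : \prod_(i < n.+1) F i (tnth (tcons z) i) = F ord0 z.1 * G z.2.
  case: z => x t; rewrite big_ord_recl tnth_tcons0.
  by under eq_bigr do rewrite tnth_tconsS.
have iR : (lam \x tensor_power lam n)%E.-integrable setT (EFin \o (
    (fun x => complex.Re (\prod_(i < n.+1) F i (tnth x i))) \o @tcons d S n)).
  rewrite (_ : _ \o _ = (fun z => complex.Re (F ord0 z.1) * complex.Re (G z.2) -
      complex.Im (F ord0 z.1) * complex.Im (G z.2))); last first.
    by apply/funext => z /=; rewrite E1 ReM.
  apply: integrable_EFinB.
    exact: (integrable_prod_mul FR GR).
  exact: (integrable_prod_mul FI GI).
have iI : (lam \x tensor_power lam n)%E.-integrable setT (EFin \o (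
    (fun x => complex.Im (\prod_(i < n.+1) F i (tnth x i))) \o @tcons d S n)).
  rewrite (_ : _ \o _ = (fun z => complex.Re (F ord0 z.1) * complex.Im (G z.2) +
      complex.Im (F ord0 z.1) * complex.Re (G z.2))); last first.
    by apply/funext => z /=; rewrite E1 ImM.
  apply: integrable_EFinD.
    exact: (integrable_prod_mul FR GI).
  exact: (integrable_prod_mul FI GR).
have [iR1 ER] := tensor_integrableS iR; have [iI1 EI] := tensor_integrableS iI.
split; first by split.
rewrite big_ord_recl -GE; apply/eqP.
rewrite eq_complex ReM ImM /cintegral/= -/G ER EI.
under eq_Rintegral do rewrite E1 ReM.
under [X in _ && (X == _)]eq_Rintegral do rewrite E1 ImM.
rewrite RintegralB//;
  [|exact: (integrable_prod_mul FR GR)|exact: (integrable_prod_mul FI GI)].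
rewrite RintegralD//;
  [|exact: (integrable_prod_mul FR GI)|exact: (integrable_prod_mul FI GR)].
rewrite (Rintegral_prod_mul FR GR) (Rintegral_prod_mul FI GI).
by rewrite (Rintegral_prod_mul FR GI) (Rintegral_prod_mul FI GR) !eqxx.
Qed.

End tensor_complex_integral.

(** * The Andreief identity *)

Section square_integrable.
Context (R : realType).

Lemma ler_norm_mul2 (a b c e : R) :
  `|a * b + c * e| <= (a ^+ 2 + c ^+ 2) + (b ^+ 2 + e ^+ 2).
Proof.
have := sqr_ge0 (a - b); have := sqr_ge0 (c - e).
have := sqr_ge0 (a + b); have := sqr_ge0 (c + e).
have := sqr_ge0 a; have := sqr_ge0 b; have := sqr_ge0 c; have := sqr_ge0 e.
by rewrite ler_norml => *; apply/andP; split; nra.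
Qed.

Lemma normc_sqrE (z : R[i]) :
  Normc.normc z ^+ 2 = complex.Re z ^+ 2 + complex.Im z ^+ 2.
Proof. by case: z => a b /=; rewrite sqr_sqrtr// addr_ge0 ?sqr_ge0. Qed.

Lemma Re_conjC (z : R[i]) : complex.Re z^* = complex.Re z.
Proof. by case: z. Qed.

Lemma Im_conjC (z : R[i]) : complex.Im z^* = - complex.Im z.
Proof. by case: z. Qed.

Lemma normc_sqrC (z : R[i]) : (Normc.normc z ^+ 2)%:C = z^* * z.
Proof.
apply/eqP; rewrite eq_complex ReM ImM Re_conjC Im_conjC /= normc_sqrE.
by rewrite mulNr opprK -!expr2 eqxx /= mulNr mulrC addrN.
Qed.

Context d (T : measurableType d) (mu : {measure set T -> \bar R}).

(** Membership in the space of square integrable functions, with the integral of the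
    squared modulus in place of the norm. *)
Definition square_integrable (f : T -> R[i]) : Prop :=
  cmeasurable f /\ (\int[mu]_x (Normc.normc (f x) ^+ 2)%:E < +oo)%E.

Lemma measurable_normc_sqr (f : T -> R[i]) : cmeasurable f ->
  measurable_fun setT (fun x => Normc.normc (f x) ^+ 2).
Proof.
move=> [mR mI]; under eq_fun do rewrite normc_sqrE.
by apply: measurable_funD; exact: measurable_funX.
Qed.

Lemma integrable_normc_sqr (f : T -> R[i]) : square_integrable f ->
  mu.-integrable setT (EFin \o (fun x => Normc.normc (f x) ^+ 2)).
Proof.
move=> [mf fl]; apply/integrableP; split.
  by apply/measurable_EFinP; exact: measurable_normc_sqr.
by under eq_integral do rewrite /= ger0_norm ?sqr_ge0//.
Qed.

Lemma cintegrable_conj_mul (f g : T -> R[i]) :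
  square_integrable f -> square_integrable g ->
  cintegrable mu (fun x => (f x)^* * g x).
Proof.
move=> fs gs; have [[fR fI] _] := fs; have [[gR gI] _] := gs.
have fgi := integrable_EFinD (integrable_normc_sqr fs)
  (integrable_normc_sqr gs).
split.
  apply: (le_integrable measurableT _ _ fgi).
    apply/measurable_EFinP; under eq_fun do rewrite ReM Re_conjC Im_conjC.
    by apply: measurable_funB; apply: measurable_funM => //;
      exact: measurable_funN.
  move=> x _; rewrite lee_fin ReM Re_conjC Im_conjC mulNr opprK [leRHS]ger0_norm
    ?addr_ge0 ?sqr_ge0//.
  rewrite !normc_sqrE; exact: ler_norm_mul2.
apply: (le_integrable measurableT _ _ fgi).
  apply/measurable_EFinP; under eq_fun do rewrite ImM Re_conjC Im_conjC.
  by apply: measurable_funD; apply: measurable_funM => //;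
    exact: measurable_funN.
move=> x _; rewrite lee_fin ImM Re_conjC Im_conjC mulNr -mulrN [leRHS]ger0_norm
  ?addr_ge0 ?sqr_ge0//.
rewrite !normc_sqrE; apply: (le_trans (ler_norm_mul2 _ _ _ _)).
by rewrite sqrrN (addrC (complex.Im (g x) ^+ 2)).
Qed.

End square_integrable.

Section andreief.
Context (R : realType) (d : measure_display) (T : baseSpaceType d).
Variable lam : {sigma_finite_measure set T -> \bar R}.
Variables (n : nat) (f : 'I_n -> T -> R[i]).
Hypothesis sf : forall i, square_integrable lam (f i).

(** The Gram matrix of a finite family of square integrable functions. *)
Definition gram : 'M[R[i]]_n :=
  \matrix_(i, j) cintegral lam setT (fun y => (f i y)^* * f j y).

(** The matrix of the values of the family at the points of a tuple. *)
Definition evaluation (y : n.-tuple T) : 'M[R[i]]_n :=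
  \matrix_(i, j) f j (tnth y i).

Lemma det_evaluation_sqrE y : (\det (evaluation y))^* * \det (evaluation y) =
  \sum_(s : 'S_n) \sum_(t : 'S_n) ((-1) ^+ s * (-1) ^+ t) *
     \prod_(i < n) ((f (s i) (tnth y i))^* * f (t i) (tnth y i)).
Proof.
rewrite /determinant rmorph_sum/= mulr_suml; apply: eq_bigr => s _.
rewrite mulr_sumr; apply: eq_bigr => t _.
rewrite rmorphM/= rmorph_sign rmorph_prod/= big_split/= mulrACA.
by congr (_ * (_ * _)); apply: eq_bigr => i _; rewrite mxE.
Qed.

(** For fixed [s] the sum over [t] is the determinant of [G] with rows permuted by
    [s], so that the two signs of [s] cancel. *)
Lemma sum_perm_pairs_det (G : 'M[R[i]]_n) :
  \sum_(s : 'S_n) \sum_(t : 'S_n) ((-1) ^+ s * (-1) ^+ t) *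
    \prod_(i < n) G (s i) (t i) = n`!%:R * \det G.
Proof.
rewrite (eq_bigr (fun=> \det G)).
  by rewrite sumr_const card_Sn mulr_natl.
move=> s _; under eq_bigr do rewrite -mulrA.
rewrite -mulr_sumr.
transitivity ((-1) ^+ s * \det (row_perm s G)).
  congr (_ * _); rewrite /determinant; apply: eq_bigr => t _; congr (_ * _).
  by apply: eq_bigr => i _; rewrite mxE.
by rewrite row_permE det_mulmx det_perm mulrA -expr2 sqrr_sign mul1r.
Qed.

(** Andreief's identity: expand both determinants over permutations, integrate each
    product coordinate by coordinate, and collect the terms. *)
Lemma andreief_cintegral :
  cintegrable (tensor_power lam n)
    (fun y => (\det (evaluation y))^* * \det (evaluation y)) /\
  cintegral (tensor_power lam n) setT
    (fun y => (\det (evaluation y))^* * \det (evaluation y)) =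
    n`!%:R * \det gram.
Proof.
have prodE (s t : 'S_n) := tensor_cintegral_prod (lam := lam)
  (fun i => cintegrable_conj_mul (sf (s i)) (sf (t i))).
have ci s t : cintegrable (tensor_power lam n)
  (fun y => ((-1) ^+ (s : 'S_n) * (-1) ^+ (t : 'S_n)) *
     \prod_(i < n) ((f (s i) (tnth y i))^* * f (t i) (tnth y i))).
  by apply: cintegrableZl; have [] := prodE s t.
rewrite (funext det_evaluation_sqrE); split.
  by apply: cintegrable_sum => s; exact: cintegrable_sum.
rewrite cintegral_sum => [|s]; last exact: cintegrable_sum.
rewrite -sum_perm_pairs_det; apply: eq_bigr => s _.
rewrite cintegral_sum//; apply: eq_bigr => t _.
have [iP EP] := prodE s t; rewrite cintegralZl// EP; congr (_ * _).
by apply: eq_bigr => i _; rewrite mxE.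
Qed.

(** The real form of Andreief's identity: the determinant of the Gram matrix is a
    real number, equal to the normalised integral of the squared modulus of the
    determinant of the values. *)
Lemma andreief : exists2 r : R, \det gram = r%:C &
  (\int[tensor_power lam n]_y (Normc.normc (\det (evaluation y)) ^+ 2 /
    n`!%:R)%:E
   = r%:E)%E.
Proof.
have [[iR _] E] := andreief_cintegral.
have f0 : n`!%:R != 0 :> R by rewrite pnatr_eq0 -lt0n fact_gt0.
have iN : (tensor_power lam n).-integrable setT
    (EFin \o (fun y => Normc.normc (\det (evaluation y)) ^+ 2)).
  apply: (eq_integrable measurableT _ _ _ iR) => y _ /=.
  by rewrite -normc_sqrC.
exists ((\int[tensor_power lam n]_y Normc.normc (\det (evaluation y)) ^+ 2)%R /
  n`!%:R).
  apply: (@mulfI _ (n`!%:R : R[i])); first by rewrite pnatr_eq0 -lt0n fact_gt0.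
  rewrite -E /cintegral rmorphM/= fmorphV/= rmorph_nat mulrCA mulfV ?mulr1;
    last first.
    by rewrite pnatr_eq0 -lt0n fact_gt0.
  apply/eqP; rewrite eq_complex /=; apply/andP; split; apply/eqP.
    by apply: eq_Rintegral => y _; rewrite -normc_sqrC.
  rewrite -[RHS](mul0r (fine (tensor_power lam n setT))).
  rewrite -[RHS](@Rintegral_cst _ _ _ (tensor_power lam n))//.
  by apply: eq_Rintegral => y _; rewrite -normc_sqrC.
under eq_integral do rewrite EFinM.
rewrite integralZr// [in RHS]EFinM /Rintegral fineK//.
exact: (integrable_fin_num measurableT iN).
Qed.

Lemma gram_psd : psd gram.
Proof.
split=> [i j|u].
  rewrite !mxE /cintegral; apply/eqP; rewrite eq_complex Re_conjC Im_conjC /=.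
  apply/andP; split; apply/eqP.
    by apply: eq_Rintegral => y _; rewrite !ReM !Re_conjC !Im_conjC; ring.
  rewrite -[RHS]mulN1r -RintegralZl//; last first.
    by have [] := cintegrable_conj_mul (sf i) (sf j).
  by apply: eq_Rintegral => y _; rewrite !ImM !Re_conjC !Im_conjC; ring.
pose h y := \sum_j u j * f j y.
have hE y : (h y)^* * h y =
    \sum_i \sum_j ((u i)^* * u j) * ((f i y)^* * f j y).
  rewrite /h rmorph_sum/= mulr_suml; apply: eq_bigr => i _.
  rewrite mulr_sumr; apply: eq_bigr => j _.
  by rewrite rmorphM/= mulrACA.
have ci i j : cintegrable lam (fun y => ((u i)^* * u j) * ((f i y)^* * f j y)).
  exact/cintegrableZl/cintegrable_conj_mul.
have -> : \sum_i \sum_j (u i)^* * gram i j * u j =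
    cintegral lam setT (fun y => (h y)^* * h y).
  rewrite (funext hE) cintegral_sum => [|i]; last exact: cintegrable_sum.
  apply: eq_bigr => i _; rewrite cintegral_sum//; apply: eq_bigr => j _.
  rewrite cintegralZl; last exact: cintegrable_conj_mul.
  by rewrite mxE mulrAC.
rewrite lecE /cintegral/=; apply/andP; split.
  apply/eqP; rewrite -[RHS](mul0r (fine (lam setT))).
  rewrite -[RHS](@Rintegral_cst _ _ _ lam)//.
  by apply: eq_Rintegral => y _; rewrite -normc_sqrC.
apply: Rintegral_ge0 => y _; rewrite -normc_sqrC/=; exact: sqr_ge0.
Qed.

Lemma gram_diagE i : gram i i = ((\int[lam]_y Normc.normc (f i y) ^+ 2)%R)%:C.
Proof.
rewrite mxE /cintegral; apply/eqP; rewrite eq_complex /=; apply/andP; split;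
  apply/eqP.
  by apply: eq_Rintegral => y _; rewrite -normc_sqrC.
rewrite -[RHS](mul0r (fine (lam setT))).
rewrite -[RHS](@Rintegral_cst _ _ _ lam)//.
by apply: eq_Rintegral => y _; rewrite -normc_sqrC.
Qed.

Lemma andreief_hadamard :
  (\int[tensor_power lam n]_y (Normc.normc (\det (evaluation y)) ^+ 2 /
    n`!%:R)%:E
   <= \prod_(i < n) \int[lam]_y (Normc.normc (f i y) ^+ 2)%:E)%E.
Proof.
have [r rE ->] := andreief.
have := hadamard gram_psd; rewrite rE.
under eq_bigr do rewrite gram_diagE.
rewrite -rmorph_prod/= lecR => h.
apply: (@le_trans _ _ (\prod_(i < n) (\int[lam]_y Normc.normc (f i y) ^+
  2)%R)%:E).
  by rewrite lee_fin.
rewrite (big_morph EFin EFinM (erefl 1%:E)).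
rewrite le_eqVlt; apply/orP; left; apply/eqP; apply: eq_bigr => i _.
rewrite /Rintegral fineK//.
exact: (integrable_fin_num measurableT (integrable_normc_sqr (sf i))).
Qed.

End andreief.

(** * Factorial moments and the law of a count *)

Section bonferroni.
Context (R : realType).

Lemma alternating_bin_sum n k :
  \sum_(j < k.+1) (-1) ^+ j * ('C(n.+1, j))%:R = (-1) ^+ k * ('C(n, k))%:R :> R.
Proof.
elim: k => [|k IH]; first by rewrite big_ord1 !bin0.
rewrite big_ord_recr/= IH binS natrD exprS; ring.
Qed.

(** The factorial power of [N] of order [m + j], divided by [m! j!]; it equals
    [C(N, m) * C(N - m, j)]. *)
Definition binomial_moment (m j N : nat) : R :=
  (N ^_ (m + j))%:R / (m`! * j`!)%:R.

Lemma binomial_momentE m j N :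
  binomial_moment m j N = ('C(N, m) * 'C(N - m, j))%:R.
Proof.
have f0 : (m`! * j`!)%:R != 0 :> R by rewrite pnatr_eq0 -lt0n muln_gt0
  !fact_gt0.
apply/(mulIf f0); rewrite /binomial_moment divfK// -natrM; congr _%:R.
rewrite mulnACA !bin_ffact; elim: m {f0} N => [|m IH] N.
  by rewrite ffactn0 mul1n subn0.
case: N => [|N]; first by rewrite addSn !ffact0n.
by rewrite addSn !ffactSS subSS IH mulnA.
Qed.

(** The alternating sum that computes the indicator of [N = m] by inclusion and
    exclusion, cut after [k] terms, is off by at most the next term. *)
Lemma bonferroni (m k N : nat) :
  `|(N == m)%:R - \sum_(j < k) (-1) ^+ j * binomial_moment m j N|
    <= binomial_moment m k N.
Proof.
under eq_bigr do rewrite binomial_momentE natrM mulrCA.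
rewrite -mulr_sumr binomial_momentE natrM.
have [Nm|Nm|->] := ltngtP N m.
- by rewrite bin_small// !mul0r subr0 normr0.
- case: k => [|k].
    by rewrite big_ord0 mulr0 subr0 normr0 mulr_ge0.
  have [n nE] : exists n, (N - m = n.+1)%N.
    by exists (N - m).-1; rewrite prednK// subn_gt0.
  rewrite nE alternating_bin_sum sub0r normrN normrM normr_nat ler_wpM2l//.
  by rewrite normrM normrX normrN1 expr1n mul1r normr_nat ler_nat
     binS leq_addl.
- rewrite binn mul1r subnn; case: k => [|k].
    by rewrite big_ord0 subr0 normr1 bin0 mul1r.
  rewrite big_ord_recl big1 ?addr0 ?expr0 ?bin0 ?mul1r ?subrr ?normr0//.
  by move=> i _; rewrite bin_small// mulr0.
Qed.

End bonferroni.

Section factorial_moments.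
Context (R : realType) d (T : measurableType d) (P : probability T R).
Variables (N : T -> nat) (M : nat -> R).
Hypothesis mN : measurable_fun setT N.
Hypothesis NM : forall n, (\int[P]_w ((N w) ^_ n)%:R%:E = (M n)%:E)%E.

Lemma measurable_nat_comp (g : nat -> R) : measurable_fun setT (g \o N).
Proof. by apply: measurableT_comp => // _ Y mY; exact: I. Qed.

Lemma integrable_ffact n :
  P.-integrable setT (EFin \o (fun w => ((N w) ^_ n)%:R)).
Proof.
apply/integrableP; split.
  exact/measurable_EFinP/(measurable_nat_comp (fun k => (k ^_ n)%:R)).
under eq_integral => w _ do rewrite /= ger0_norm ?ler0n//.
by rewrite NM ltry.
Qed.

Lemma Rintegral_ffact n : (\int[P]_w ((N w) ^_ n)%:R)%R = M n.
Proof. by rewrite /Rintegral NM. Qed.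

Lemma factorial_moment_ge0 n : 0 <= M n.
Proof. by rewrite -Rintegral_ffact Rintegral_ge0. Qed.

Lemma integrable_binomial_moment m j :
  P.-integrable setT (EFin \o (fun w => binomial_moment R m j (N w))).
Proof.
have := integrableZr measurableT (m`! * j`!)%:R^-1 (integrable_ffact (m + j)).
by [].
Qed.

Lemma Rintegral_binomial_moment m j :
  (\int[P]_w binomial_moment R m j (N w))%R = M (m + j)%N / (m`! * j`!)%:R.
Proof.
rewrite RintegralZr//; last exact: integrable_ffact.
by rewrite Rintegral_ffact.
Qed.

Lemma measurable_nat_preimage (Y : set nat) : measurable (N @^-1` Y).
Proof. by rewrite -[X in measurable X]setTI; apply: mN. Qed.

Lemma integrable_prob_indic (A : set T) : measurable A ->
  P.-integrable setT (EFin \o \1_A).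
Proof. exact: integrable_indic. Qed.

Lemma fine_prob_indic (A : set T) : measurable A ->
  fine (P A) = (\int[P]_w \1_A w)%R.
Proof. by move=> mA; rewrite /Rintegral integral_indic// setIT. Qed.

(** Bonferroni's inequality integrated: the probability that [N = m] is approximated by
    partial sums in the factorial moments [M n] of [N]. *)
Lemma probability_bonferroni (m k : nat) :
  `|fine (P (N @^-1` [set m]))
      - \sum_(j < k) (-1) ^+ j * (M (m + j)%N / (m`! * j`!)%:R)|
    <= M (m + k)%N / (m`! * k`!)%:R.
Proof.
have mA := measurable_nat_preimage [set m].
have iA := integrable_prob_indic mA.
have iB j : P.-integrable setT
    (EFin \o (fun w => (-1) ^+ j * binomial_moment R m j (N w))).
  exact/integrable_EFinZl/integrable_binomial_moment.
have iS := integrable_EFin_sum (index_enum 'I_k) (fun j => iB (nat_of_ord j)).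
rewrite fine_prob_indic//.
have -> : \sum_(j < k) (-1) ^+ j * (M (m + j)%N / (m`! * j`!)%:R) =
    (\int[P]_w \sum_(j < k) (-1) ^+ j * binomial_moment R m j (N w))%R.
  rewrite Rintegral_sum//; apply: eq_bigr => j _.
  rewrite RintegralZl ?Rintegral_binomial_moment//.
  exact: integrable_binomial_moment.
rewrite -RintegralB// -Rintegral_binomial_moment.
have iD := integrable_EFinB iA iS.
(* The pointwise inequality [bonferroni] is integrated. *)
apply: (le_trans (le_normr_Rintegral measurableT iD)).
apply: le_Rintegral => //.
- by move: iD => /integrable_abse.
- exact: integrable_binomial_moment.
move=> w _; rewrite indicE.
rewrite (_ : (w \in _) = (N w == m)); last by apply/idP/eqP; rewrite inE.
by have := bonferroni R m k (N w).
Qed.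

(** When [M 2 <= (M 1)^2] the variance of [N] is at most its mean [M 1], and
    Chebyshev's inequality bounds the probability that [N <= m]. *)
Lemma chebyshev_count (m : nat) : M 2 <= M 1 ^+ 2 -> m%:R <= M 1 ->
  fine (P (N @^-1` [set n | (n < m.+1)%N])) * (M 1 - m%:R) ^+ 2 <= M 1.
Proof.
move=> M21 mM1; have mA := measurable_nat_preimage [set n | (n < m.+1)%N].
have iA := integrable_prob_indic mA.
have i1 := integrable_ffact 1; have i2 := integrable_ffact 2.
(* [q] is [(N - M 1)^2], written with factorial powers. *)
pose q w : R := ((N w) ^_ 2)%:R + ((1 - 2 * M 1) * ((N w) ^_ 1)%:R + M 1 ^+ 2).
have iq1 : P.-integrable setT
    (EFin \o (fun w => (1 - 2 * M 1) * ((N w) ^_ 1)%:R + M 1 ^+ 2)).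
  apply: integrable_EFinD; first exact: integrable_EFinZl.
  exact: finite_measure_integrable_cst.
have iq : P.-integrable setT (EFin \o q) by exact: integrable_EFinD.
have qE : (\int[P]_w q w)%R = M 2 + M 1 - M 1 ^+ 2.
  rewrite /q RintegralD// RintegralD//; last 2 first.
    exact: integrable_EFinZl.
    exact: finite_measure_integrable_cst.
  rewrite RintegralZl// !Rintegral_ffact Rintegral_cst//.
  rewrite (congr1 fine (probability_setT P) : fine _ = 1).
  by ring.
have : (\int[P]_w ((M 1 - m%:R) ^+ 2 * \1_(N @^-1` [set n | (n < m.+1)%N]) w))%R
    <= (\int[P]_w q w)%R.
  apply: le_Rintegral => //; first exact: integrable_EFinZl.
  move=> w _; rewrite indicE.
  have qsq : q w = ((N w)%:R - M 1) ^+ 2.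
    rewrite /q ffactn1; case: (N w) => [|k]; first by rewrite ffact0n !mulr0n;
      ring.
    by rewrite ffactSS ffactn1 natrM /= -natr1; ring.
  rewrite qsq; have [|_] := boolP (w \in _); last by rewrite mulr0 sqr_ge0.
  rewrite inE/= ltnS mulr1 => Nm.
  rewrite -[leRHS]sqrrN opprB ler_sqr ?nnegrE ?subr_ge0//.
    by rewrite lerB// ler_nat.
  by rewrite (le_trans _ mM1)// ler_nat.
rewrite RintegralZl// -fine_prob_indic// mulrC => /le_trans; apply.
by rewrite qE; lra.
Qed.

End factorial_moments.

Section count_law.
Context (R : realType) d (T : measurableType d) (P : probability T R).
Variables (N : nat -> T -> nat) (M : nat -> nat -> R).
Hypothesis mN : forall k, measurable_fun setT (N k).
Hypothesis ndN : forall w, nondecreasing_seq (N ^~ w).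
Hypothesis NM : forall k n, (\int[P]_w ((N k w) ^_ n)%:R%:E = (M k n)%:E)%E.

(** The event that all the counts [N k] stay below [j]. *)
Definition count_below (j : nat) : set T := [set w | forall k, (N k w < j)%N].

Lemma count_belowE j :
  count_below j = \bigcap_k (N k @^-1` [set n | (n < j)%N]).
Proof.
by apply/seteqP; split => [w h k _|w h k]; [exact: h|exact: (h k I)].
Qed.

Lemma measurable_count_below j : measurable (count_below j).
Proof.
rewrite count_belowE; apply: bigcap_measurable; first by exists 0%N.
by move=> k _; exact: (measurable_nat_preimage (mN k)).
Qed.

Lemma cvg_count_below j :
  fine (P (N k @^-1` [set n | (n < j)%N])) @[k --> \oo]
    --> fine (P (count_below j)).
Proof.
have mNk k := measurable_nat_preimage (mN k) [set n | (n < j)%N].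
apply: fine_cvg; rewrite fineK ?fin_num_measure//;
  last exact: measurable_count_below.
rewrite count_belowE; apply: nonincreasing_cvg_mu => //.
- by rewrite -ge0_fin_numE// fin_num_measure.
- by rewrite -count_belowE; exact: measurable_count_below.
- move=> k l kl; apply/subsetPset => w /=; apply: leq_ltn_trans.
  exact: ndN.
Qed.

Lemma count_belowS m : count_below m `<=` count_below m.+1.
Proof. by move=> w h k; rewrite ltnW// ltnS. Qed.

(** As the counts [N k] increase, the events [N k < j] decrease to [count_below j]. *)
Lemma cvg_count_eq m :
  fine (P (N k @^-1` [set m])) @[k --> \oo]
    --> fine (P (count_below m.+1 `\` count_below m)).
Proof.
have mC j := measurable_count_below j.
have -> : fine (P (count_below m.+1 `\` count_below m)) =
    fine (P (count_below m.+1)) - fine (P (count_below m)).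
  rewrite measureD//; last by rewrite -ge0_fin_numE// fin_num_measure.
  rewrite setIidr; last exact: count_belowS.
  by rewrite fineB ?fin_num_measure.
rewrite (_ : (fun k => _) = (fun k =>
   fine (P (N k @^-1` [set n | (n < m.+1)%N])) -
   fine (P (N k @^-1` [set n | (n < m)%N])))); last first.
  apply/funext => k.
  have mNk Y := measurable_nat_preimage (mN k) Y.
  have -> : N k @^-1` [set m] = N k @^-1` [set n | (n < m.+1)%N] `\`
       N k @^-1` [set n | (n < m)%N].
    apply/seteqP; split => [w /= ->|w /= []].
      by rewrite ltnn ltnSn.
    by rewrite ltnS => h /negP; rewrite -leqNgt => h'; apply/eqP;
      rewrite eqn_leq h.
  rewrite measureD//; last by rewrite -ge0_fin_numE// fin_num_measure.
  rewrite setIidr; last by move=> w /= h; rewrite ltnW// ltnS.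
  by rewrite fineB ?fin_num_measure.
by apply: cvgB; exact: cvg_count_below.
Qed.

Lemma count_law_bound (mu : nat -> R) (c : R) :
  (forall n, M k n @[k --> \oo] --> mu n) -> (forall k n, M k n <= c ^+ n) ->
  forall m K,
  `|fine (P (count_below m.+1 `\` count_below m))
      - \sum_(j < K) (-1) ^+ j * (mu (m + j)%N / (m`! * j`!)%:R)|
    <= c ^+ (m + K) / (m`! * K`!)%:R.
Proof.
move=> Mmu Mc m K.
pose u k := fine (P (N k @^-1` [set m]))
      - \sum_(j < K) (-1) ^+ j * (M k (m + j)%N / (m`! * j`!)%:R).
have cu : `|u k| @[k --> \oo] -->
  `|fine (P (count_below m.+1 `\` count_below m))
      - \sum_(j < K) (-1) ^+ j * (mu (m + j)%N / (m`! * j`!)%:R)|.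
  apply: cvg_norm; apply: cvgB; first exact: cvg_count_eq.
  apply: cvg_big => [|j _]; first exact: add_continuous.
  apply: cvgM; first exact: cvg_cst.
  by apply: cvgM; [exact: Mmu|exact: cvg_cst].
rewrite -(cvg_lim _ cu)//; apply: limr_le; first by apply/cvg_ex; eexists;
  exact: cu.
near=> k; apply: (le_trans (probability_bonferroni (mN k) (NM k) m K)).
by rewrite ler_wpM2r// invr_ge0.
Unshelve. all: by end_near. Qed.

(** When the means grow to infinity, the counts are almost surely unbounded. *)
Lemma count_law_infinite m : (forall k, M k 2 <= M k 1 ^+ 2) ->
  M k 1 @[k --> \oo] --> +oo ->
  fine (P (count_below m.+1)) = 0.
Proof.
move=> M21 Moo.
have mC := measurable_count_below m.+1.
have p0 : 0 <= fine (P (count_below m.+1)) by rewrite fine_ge0.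
apply/eqP; rewrite eq_le p0 andbT; apply/ler_addgt0Pl => e e0; rewrite addr0.
(* A mean of at least [2 m] makes the Chebyshev bound at most [4 / M k 1]. *)
have /cvgryPge/(_ (2 * m%:R + 1 + 4 / e)) [k _ /(_ k (leqnn k))/= Mk] := Moo.
have M0 : 0 <= M k 1 := factorial_moment_ge0 (NM k) 1.
have e4 : 0 < 4 / e by rewrite divr_gt0.
have m0 : 0 <= m%:R :> R by [].
have mM : m%:R <= M k 1 by lra.
have := chebyshev_count (mN k) (NM k) (M21 k) mM.
set p := fine (P (N k @^-1` _)) => pM.
have pp : fine (P (count_below m.+1)) <= p.
  rewrite fine_le ?fin_num_measure//;
    first exact: (measurable_nat_preimage (mN k)).
  rewrite le_measure ?inE//; first exact: (measurable_nat_preimage (mN k)).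
  by move=> w /(_ k).
apply: (le_trans pp).
have p0' : 0 <= p by exact: le_trans pp.
have h1 : M k 1 <= 2 * (M k 1 - m%:R) by lra.
have h2 : 0 < M k 1 by lra.
have h3 : M k 1 * p <= 4.
  have : p * (M k 1 / 2) ^+ 2 <= M k 1.
    apply: le_trans pM; rewrite ler_wpM2l// ler_sqr ?nnegrE; lra.
  by move=> h; rewrite -(ler_pM2r h2); nra.
have h4 : 4 / e * p <= 4.
  by apply: le_trans h3; rewrite ler_wpM2r//; lra.
by move: h4; rewrite mulrAC ler_pdivrMr// ler_pM2l.
Qed.

End count_law.

Section count_law_unique.
Context (R : realType).

(** The nondecreasing integer random variables [N k] have factorial moments [M k n],
    bounded by [(M k 1)^n] and converging to the possibly infinite [mu n]; the means
    [M k 1] are at most [mu 1]. In the application [N k] counts the points of a process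
    in the [k]-th set of an exhaustion, and [mu n] is the factorial moment of order [n]
    of the full count. *)
Definition exhausts d (T : measurableType d) (P : probability T R)
    (N : nat -> T -> nat) (M : nat -> nat -> R) (mu : nat -> \bar R) : Prop :=
  [/\ forall k, measurable_fun setT (N k),
      forall w, nondecreasing_seq (N ^~ w),
      forall k n, (\int[P]_w ((N k w) ^_ n)%:R%:E = (M k n)%:E)%E,
      forall k n, M k n <= M k 1 ^+ n &
      (forall k, ((M k 1)%:E <= mu 1%N)%E) /\
      forall n, (M k n)%:E @[k --> \oo] --> mu n].

(** The event that the supremum of the counts is [m]. *)
Definition count_eq d (T : measurableType d) (N : nat -> T -> nat) m : set T :=
  count_below N m.+1 `\` count_below N m.

Lemma exhausts_infinite d (T : measurableType d) (P : probability T R) N M mu m :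
  exhausts P N M mu -> mu 1%N = +oo%E -> P (count_eq N m) = 0%E.
Proof.
move=> [mN ndN NM Mle [Mmu cM]] mu1.
have mC := measurable_count_below mN.
have M1oo : M k 1 @[k --> \oo] --> +oo by apply/cvgeryP; rewrite -mu1;
  exact: cM.
have P0 : P (count_below N m.+1) = 0%E.
  rewrite -[LHS]fineK ?fin_num_measure//.
  by rewrite (count_law_infinite mN NM m (fun k => Mle k 2%N) M1oo).
apply/eqP; rewrite eq_le measure_ge0 andbT -P0.
apply: le_measure; rewrite ?inE//; [exact: measurableD|by move=> w []].
Qed.

(** The bound does not depend on the index [k], so it passes to the limit. *)
Lemma exhausts_finite d (T : measurableType d) (P : probability T R) N M mu m K :
  exhausts P N M mu -> (mu 1%N < +oo)%E ->
  `|fine (P (count_eq N m))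
      - \sum_(j < K) (-1) ^+ j * (fine (mu (m + j)%N) / (m`! * j`!)%:R)|
    <= fine (mu 1%N) ^+ (m + K) / (m`! * K`!)%:R.
Proof.
move=> [mN ndN NM Mle [Mmu cM]] mu1.
have M0 k n : 0 <= M k n := factorial_moment_ge0 (NM k) n.
have mu1f : mu 1%N \is a fin_num.
  by rewrite ge0_fin_numE// (le_trans _ (Mmu 0%N))// lee_fin.
have Mc k n : M k n <= fine (mu 1%N) ^+ n.
  apply: (le_trans (Mle k n)); rewrite lerXn2r ?nnegrE//.
    by rewrite fine_ge0// (le_trans _ (Mmu 0%N))// lee_fin.
  by rewrite -lee_fin fineK.
have := @count_law_bound R d T P N M mN ndN NM (fun n => fine (mu n))
  (fine (mu 1%N)) _ Mc m K; apply => n.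
have muf : mu n \is a fin_num.
  rewrite ge0_fin_numE; last first.
    rewrite -(cvg_lim _ (cM n))//; apply: lime_ge.
      by apply/cvg_ex; eexists; exact: cM.
    by apply: nearW => k; rewrite lee_fin.
  apply: (@le_lt_trans _ _ (fine (mu 1%N) ^+ n)%:E); last exact: ltry.
  rewrite -(cvg_lim _ (cM n))//; apply: lime_le.
    by apply/cvg_ex; eexists; exact: cM.
  by apply: nearW => k; rewrite lee_fin.
by apply: (@fine_cvg _ _ _ _ (fun k => (M k n)%:E)); rewrite fineK.
Qed.

(** The limiting moments determine the law of the supremum of the counts: if the mean
    is infinite, so is the supremum almost surely; otherwise the probabilities are
    the sums of the same convergent alternating series. *)
Lemma exhausts_unique d1 d2 (T1 : measurableType d1) (T2 : measurableType d2)
    (P1 : probability T1 R) (P2 : probability T2 R) N1 N2 M1 M2 mu m :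
  exhausts P1 N1 M1 mu -> exhausts P2 N2 M2 mu ->
  P1 (count_eq N1 m) = P2 (count_eq N2 m).
Proof.
move=> e1 e2; have [mu1|mu1] := ltP (mu 1%N) +oo%E; last first.
  by move: mu1; rewrite leye_eq => /eqP mu1;
     rewrite (exhausts_infinite _ e1)// (exhausts_infinite _ e2).
have mC1 : measurable (count_eq N1 m).
  by case: e1 => mN *; apply: measurableD; exact: measurable_count_below.
have mC2 : measurable (count_eq N2 m).
  by case: e2 => mN *; apply: measurableD; exact: measurable_count_below.
rewrite -[LHS]fineK ?fin_num_measure// -[RHS]fineK ?fin_num_measure//.
congr EFin; apply/eqP; rewrite -subr_eq0 -normr_le0.
set c := fine (mu 1%N); set p := fine _; set q := fine _.
have pq K : `|p - q| <= 2 * (c ^+ m / m`!%:R) * exp_coeff c K.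
  rewrite (_ : 2 * _ * _ = c ^+ (m + K) / (m`! * K`!)%:R +
                           c ^+ (m + K) / (m`! * K`!)%:R); last first.
    rewrite /exp_coeff/= natrM invfM exprD; ring.
  apply: le_trans (lerD (exhausts_finite m K e1 mu1)
    (exhausts_finite m K e2 mu1)).
  by rewrite -/p -/q (distrC q) ler_distD.
have : 2 * (c ^+ m / m`!%:R) * exp_coeff c K @[K --> \oo] -->
    2 * (c ^+ m / m`!%:R) * 0.
  apply: cvgM; first exact: cvg_cst.
  exact/cvg_series_cvg_0/is_cvg_series_exp_coeff.
rewrite mulr0 => cv; rewrite -(cvg_lim _ cv)//; apply: limr_ge.
  by apply/cvg_ex; eexists; exact: cv.
by apply: nearW => K; exact: pq.
Qed.

End count_law_unique.

(** * Base spaces and measurability of counts *)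

Section base_space_topology.
Context (R : realType) (d : measure_display) (S : baseSpaceType d).

Lemma open_measurable_base (U : set S) : open U -> measurable U.
Proof. by move=> oU; rewrite measurable_borelE; exact: sub_sigma_algebra. Qed.

Lemma compact_measurable_base (K : set S) : compact K -> measurable K.
Proof.
move=> /(compact_closed base_hausdorff) cK.
by rewrite -[K]setCK; apply/measurableC/open_measurable_base; rewrite openC.
Qed.

(** Urysohn's lemma in the one-point compactification, where the compact set [K] and
    the complement of [V] are disjoint closed sets of a compact Hausdorff space. *)
Lemma urysohn_compact (K V : set S) : compact K -> open V -> K `<=` V ->
  exists f : S -> R, [/\ continuous f, forall x, 0 <= f x <= 1,
    forall x, K x -> f x = 1 & forall x, ~ V x -> f x = 0].
Proof.
move=> cK oV KV.
have hopc := one_point_compactification_hausdorff base_locally_compact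
  (@base_hausdorff _ S).
have nopc := compact_normal hopc (@one_point_compactification_compact S).
pose K' : set (one_point_compactification S) := Some @` K.
pose B' : set (one_point_compactification S) := ~` (Some @` V).
have clK : closed K'.
  apply: (compact_closed hopc); apply: continuous_compact => //.
  apply: continuous_subspaceT;
    exact: one_point_compactification_some_continuous.
have clB : closed B'.
  by apply: open_closedC; exact: one_point_compactification_open_some.
have BK : B' `&` K' = set0.
  apply/disjoints_subset; rewrite /B' => x /= nV [y Ky yx].
  by apply: nV; exists y => //; exact: KV.
have := (normal_separatorP (R := R)).1 nopc _ _ clB clK BK.
move=> /(@uniform_separatorP _ R)[f [cf f01 fB fK]].
exists (f \o Some); split.
- move=> x; apply: continuous_comp; last exact: cf.
  exact: one_point_compactification_some_continuous.
- move=> x; have := f01 (f (Some x)); rewrite /= in_itv/=; apply.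
  by exists (Some x).
- by move=> x Kx; apply: fK; exists (Some x) => //; exists x.
- by move=> x Vx; apply: fB; exists (Some x) => // -[y Vy [yx]];
  rewrite -yx in Vx.
Qed.

(** A base space is the union of an increasing sequence of relatively compact open
    sets. *)
Lemma exhaustion : exists U : nat -> set S,
  [/\ forall k, open (U k), forall k, exists2 C, compact C & U k `<=` C,
      nondecreasing_seq U & \bigcup_k U k = setT].
Proof.
have [B cB [Bo Bb]] := @base_second_countable _ S.
(* The relatively compact members of a countable base still cover the space. *)
pose B' := [set b | B b /\ exists2 C : set S, compact C & b `<=` C].
have cB' : countable B' by apply: sub_countable cB;
  apply: subset_card_le => b [].
have cov x : exists2 b, B' b & b x.
  have [V Vx [cV _]] := @base_locally_compact _ S x I.
  rewrite withinET in Vx.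
  have [b [Bb' bx] bV] := Bb x V Vx.
  by exists b => //; split => //; exists V.
have [B0|[f]] := pfcard_geP cB'.
  exists (fun=> setT); split.
  - by move=> _; exact: openT.
  - move=> _; exists set0; first exact: compact0.
    by move=> x _; have [b] := cov x; rewrite B0.
  - by move=> *; rewrite lexx.
  - by apply/seteqP; split => // x _; exists 0%N.
pose U k := \bigcup_(i < k) f i.
have fB i : B' (f i) by exact: funS.
exists U; split.
- by move=> k; apply: bigcup_open => i _; apply: Bo; have [] := fB i.
- elim=> [|k [C cC UC]].
    by exists set0; [exact: compact0|move=> x [j] /=; rewrite ltn0].
  have [_ [D cD fD]] := fB k.
  exists (C `|` D); first exact: compactU.
  rewrite /U => x [i /=]; rewrite ltnS leq_eqVlt => /predU1P[->|ik] fix_.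
    by right; exact: fD.
  by left; apply: UC; exists i.
- move=> k l kl; apply/subsetPset => x [i /= ik fix_]; exists i => //=.
  exact: leq_trans kl.
- apply/seteqP; split => // x _; have [b bB bx] := cov x.
  have [i _ fib] := (@surj _ _ _ _ f) b bB.
  by exists i.+1 => //; exists i => //=; rewrite fib.
Qed.

End base_space_topology.

Section conf_evaluation.
Context (R : realType) (d : measure_display) (S : baseSpaceType d).

(** By inner regularity and Urysohn's lemma [xi V] is the supremum of the integrals
    of the continuous functions between [0] and the indicator of [V]; these have
    compact support because [V] is relatively compact. Hence [xi |-> xi V] is lower
    semicontinuous for the vague topology. *)
Lemma vague_open_eval_gt (V : set S) (a : R) : open V ->
  (exists2 C : set S, compact C & V `<=` C) ->
  vague_open [set xi : conf R S | (a%:E < xi V)%E].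
Proof.
move=> oV [C cC VC].
pose F := [set f : Cc R S | (forall x, 0 <= f x <= 1) /\ forall x, ~ V x ->
  f x = 0].
(* The set is the preimage of the pointwise open set [O]. *)
pose O := \bigcup_(f in F) [set h : {ptws Cc R S -> R} | a < h f].
exists O.
  apply: bigcup_open => f _.
  rewrite (_ : [set h | _] = (fun h : {ptws Cc R S -> R} => h f) @^-1`
    [set y | a < y])//.
  apply: open_comp; last exact: open_gt.
  move=> h _ A Ahf.
  have /cvg_sup/(_ f) : nbhs h --> (h : {ptws Cc R S -> R}) by exact: cvg_id.
  apply; exact: (@initial_continuous _ _ (@^~ f) h A Ahf).
have mV := open_measurable_base oV.
have mf (f : Cc R S) : measurable_fun setT (EFin \o f).
  apply/measurable_EFinP.
  apply: (measurability _ (RGenOpens.measurableE R)) => _ [_ [x [y ->] <-]].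
  rewrite setTI; apply: open_measurable_base; apply: open_comp => [z _|].
    exact: Cc_continuous.
  exact: interval_open.
have Vfin (xi : conf R S) : (xi V < +oo)%E.
  have [/(_ C cC) Coo _ _] := conf_radon xi.
  apply: le_lt_trans Coo; apply: le_measure; rewrite ?inE//.
  exact: compact_measurable_base.
have fle (xi : conf R S) (f : Cc R S) : F f -> (\int[xi]_x (f x)%:E <= xi V)%E.
  move=> [f01 fV]; rewrite (measure_integral_indic xi mV).
  apply: ge0_le_integral => //.
  - by move=> x _; rewrite lee_fin; have /andP[] := f01 x.
  - exact: mf.
  - exact/measurable_EFinP/measurable_indic.
  move=> x _; rewrite lee_fin indicE; have [_|/negP] := boolP (x \in V).
    by have /andP[] := f01 x.
  by rewrite inE => /fV ->.
have fge0 (xi : conf R S) (f : Cc R S) : F f -> (0 <= \int[xi]_x (f x)%:E)%E.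
  by move=> [f01 _]; apply: integral_ge0 => x _; rewrite lee_fin;
    have /andP[] := f01 x.
apply/seteqP; split => xi /=.
  move=> [f Ff] /=; rewrite /conf_integral /Rintegral => af.
  apply: (@lt_le_trans _ _ (\int[xi]_x (f x)%:E)%E); last exact: fle.
  by move: af; rewrite -lte_fin fineK// ge0_fin_numE
    ?(le_lt_trans (fle _ _ Ff))//; exact: fge0.
move=> aV; have := aV.
have [_ _ /(_ V oV) ->] := conf_radon xi.
move=> /ereal_sup_gt[_ [K [cK KV] <-] aK].
have [f [cf f01 fK fV]] := urysohn_compact R cK oV KV.
have sf : exists2 K : set S, compact K & forall x, ~ K x -> f x = 0.
  by exists C => // x Cx; apply: fV => /VC.
exists (MkCc cf sf) => //=; rewrite /conf_integral /Rintegral/=.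
have Ff : F (MkCc cf sf) by split.
rewrite -lte_fin fineK; last first.
  by rewrite ge0_fin_numE ?(le_lt_trans (fle xi _ Ff))//; exact: (fge0 xi _ Ff).
apply: (lt_le_trans aK).
have mK := compact_measurable_base cK.
rewrite (measure_integral_indic xi mK); apply: ge0_le_integral => //.
- exact/measurable_EFinP/measurable_indic.
- exact: (mf (MkCc cf sf)).
move=> x _; rewrite lee_fin indicE; have [|_] := boolP (x \in K).
  by rewrite inE => /fK ->.
by have /andP[] := f01 x.
Qed.

Lemma measurable_eval_open (V : set S) : open V ->
  (exists2 C : set S, compact C & V `<=` C) ->
  measurable_fun setT (fun xi : conf R S => xi V).
Proof.
move=> oV VC; apply: (measurability _ (ErealGenOInfty.measurableE R)).
move=> _ [_ [a ->] <-]; rewrite setTI.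
have := vague_open_eval_gt a oV VC.
move=> h; apply: sub_sigma_algebra.
rewrite (_ : _ @^-1` _ = [set xi : conf R S | (a%:E < xi V)%E])//.
by apply/seteqP; split => xi /=; rewrite in_itv/= andbT.
Qed.

(** Open sets form a pi-system generating the Borel sets, and the sets [A] for which
    the conclusion holds form a lambda-system, as [xi U] is finite. *)
Lemma measurable_eval (U A : set S) : open U ->
  (exists2 C : set S, compact C & U `<=` C) -> measurable A ->
  measurable_fun setT (fun xi : conf R S => xi (A `&` U)).
Proof.
move=> oU [C cC UC].
pose H := [set A : set S | measurable A /\
   measurable_fun setT (fun xi : conf R S => xi (A `&` U))].
have mU := open_measurable_base oU.
have Ufin (xi : conf R S) (B : set S) : measurable B -> xi (B `&` U) \is a
  fin_num.
  move=> mB; rewrite ge0_fin_numE//.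
  have [/(_ C cC) Coo _ _] := conf_radon xi.
  apply: le_lt_trans Coo; apply: le_measure; rewrite ?inE//.
  - exact: measurableI.
  - exact: compact_measurable_base.
  - by move=> x [_ /UC].
suff : <<s @open S >> `<=` H by rewrite -measurable_borelE => h mA;
  have [] := h A mA.
apply: lambda_system_subset => //.
- by move=> V W; exact: openI.
- split => //.
  + split => //; rewrite setTI; apply: measurable_eval_open => //.
    by exists C.
  + move=> V W WV [mV fV] [mW fW]; split; first exact: measurableD.
    rewrite (_ : (fun _ => _) =
      (fun xi : conf R S => (xi (V `&` U) - xi (W `&` U))%E)).
      exact: emeasurable_funB.
    apply/funext => xi.
    have -> : (V `\` W) `&` U = (V `&` U) `\` (W `&` U).
      apply/seteqP; split => x /=; first by move=> [[Vx nWx] Ux];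
        split => // -[].
      by move=> [[Vx Ux] nWU]; split => //; split => // Wx; apply: nWU.
    rewrite measureD; [|exact: measurableI|exact: measurableI|].
      by rewrite (@setIidr _ (V `&` U) (W `&` U))// => x [Wx Ux]; split => //;
        exact: WV.
    by rewrite -ge0_fin_numE// Ufin.
  + move=> F ndF HF.
    have mF n : measurable (F n) by have [] := HF n.
    split; first exact: bigcupT_measurable.
    apply: (emeasurable_fun_cvg (fun n (xi : conf R S) => xi (F n `&` U))).
      by move=> n; have [] := HF n.
    move=> xi _; rewrite setI_bigcupl; apply: nondecreasing_cvg_mu.
    - by move=> n; exact: measurableI.
    - by apply: bigcupT_measurable => n; exact: measurableI.
    - move=> n m nm; apply/subsetPset => x [Fx Ux]; split => //.
      by have /subsetPset := ndF n m nm; apply.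
- move=> V oV; split; first exact: open_measurable_base.
  apply: measurable_eval_open; first exact: openI.
  by exists C => // x [_ /UC].
Qed.

Lemma bounded_borelI (U A : set S) :
  (exists2 C : set S, compact C & U `<=` C) ->
  measurable (A `&` U) -> bounded_borel (A `&` U).
Proof. by move=> [C cC UC] mAU; split => //; exists C => // x [_ /UC]. Qed.

(** A configuration is finite, hence integral, on bounded sets, so [npoints] loses
    nothing there. *)
Lemma conf_bounded_natP (xi : conf R S) (A : set S) : bounded_borel A ->
  xi A = (npoints xi A)%:R%:E.
Proof.
move=> [mA [C cC AC]]; have [Aoo|[n An]] := conf_integer xi mA.
  have [/(_ C cC) Coo _ _] := conf_radon xi.
  have : (xi A <= xi C)%E.
    by apply: le_measure; rewrite ?inE//; exact: compact_measurable_base.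
  by rewrite Aoo leye_eq => /eqP Cy; rewrite Cy in Coo.
by rewrite /npoints An/= natrK.
Qed.

Lemma measurable_npoints (U A : set S) : open U ->
  (exists2 C : set S, compact C & U `<=` C) -> measurable A ->
  measurable_fun setT (fun xi : conf R S => npoints xi (A `&` U)).
Proof.
move=> oU UC mA _ Y _; rewrite setTI.
have mAU : measurable (A `&` U) by apply: measurableI => //;
  exact: open_measurable_base.
rewrite (_ : _ @^-1` Y = \bigcup_(n in Y)
    ((fun xi : conf R S => xi (A `&` U)) @^-1` [set n%:R%:E])).
  apply: bigcup_measurable => n _; rewrite -[X in measurable X]setTI.
  by apply: (measurable_eval oU UC mA).
apply/seteqP; split => [xi Yn|xi [n Yn]] /=.
  by exists (npoints xi (A `&` U)) => //=;
    exact/conf_bounded_natP/bounded_borelI.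
by rewrite (conf_bounded_natP xi (bounded_borelI UC mAU)) => -[/eqP];
   rewrite eqr_nat => /eqP ->.
Qed.

End conf_evaluation.

(** * Factorial moments of determinantal processes *)

Section cmeasurable_closure.
Context (R : realType) d (T : measurableType d).
Implicit Types f g : T -> R[i].

Lemma cmeasurable_cst (c : R[i]) : cmeasurable (fun _ : T => c).
Proof. by split; exact: measurable_cst. Qed.

Lemma cmeasurableD f g : cmeasurable f -> cmeasurable g ->
  cmeasurable (fun x => f x + g x).
Proof.
move=> [fR fI] [gR gI]; split.
  by under eq_fun do rewrite ReD; exact: measurable_funD.
by under eq_fun do rewrite ImD; exact: measurable_funD.
Qed.

Lemma cmeasurableM f g : cmeasurable f -> cmeasurable g ->
  cmeasurable (fun x => f x * g x).
Proof.
move=> [fR fI] [gR gI]; split.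
  by under eq_fun do rewrite ReM; apply: measurable_funB;
    exact: measurable_funM.
by under eq_fun do rewrite ImM; apply: measurable_funD; exact: measurable_funM.
Qed.

Lemma cmeasurable_sum (I : Type) (r : seq I) (F : I -> T -> R[i]) :
  (forall i, cmeasurable (F i)) -> cmeasurable (fun x => \sum_(i <- r) F i x).
Proof.
move=> mF; elim: r => [|i r IH].
  by under eq_fun do rewrite big_nil; exact: cmeasurable_cst.
by under eq_fun do rewrite big_cons; exact: cmeasurableD.
Qed.

Lemma cmeasurable_prod (I : Type) (r : seq I) (F : I -> T -> R[i]) :
  (forall i, cmeasurable (F i)) -> cmeasurable (fun x => \prod_(i <- r) F i x).
Proof.
move=> mF; elim: r => [|i r IH].
  by under eq_fun do rewrite big_nil; exact: cmeasurable_cst.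
by under eq_fun do rewrite big_cons; exact: cmeasurableM.
Qed.

Lemma cmeasurable_det n (F : 'I_n -> 'I_n -> T -> R[i]) :
  (forall i j, cmeasurable (F i j)) ->
  cmeasurable (fun x => \det (\matrix_(i, j) F i j x)).
Proof.
move=> mF.
rewrite (_ : (fun _ => _) = (fun x => \sum_(s : 'S_n) (-1) ^+ s *
    \prod_i F i (s i) x)); last first.
  apply/funext => x; rewrite /determinant; apply: eq_bigr => s _.
  by congr (_ * _); apply: eq_bigr => i _; rewrite mxE.
apply: cmeasurable_sum => s; apply: cmeasurableM; first exact: cmeasurable_cst.
by apply: cmeasurable_prod => i; exact: mF.
Qed.

Lemma cmeasurable_real (f : T -> R) : measurable_fun setT f ->
  cmeasurable (fun x => (f x)%:C).
Proof. by move=> mf; split => //; exact: measurable_cst. Qed.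

Lemma cmeasurable_comp d' (T' : measurableType d') (h : T' -> T) f :
  measurable_fun setT h -> cmeasurable f -> cmeasurable (fun x => f (h x)).
Proof.
by move=> mh [fR fI]; split;
  [exact: measurableT_comp fR mh|exact: measurableT_comp fI mh].
Qed.

End cmeasurable_closure.

Section determinantal_moment.
Context (R : realType) (dS dT : measure_display).
Context (S : baseSpaceType dS) (T : baseSpaceType dT).
Variables (lamS : {sigma_finite_measure set S -> \bar R})
  (lamT : {sigma_finite_measure set T -> \bar R}).
Variable W : T -> S -> R[i].

(** The kernel [W] cut down to the rectangle [B * A]; all integrals can then be taken
    over the full spaces. *)
Definition truncated_kernel (A : set S) (B : set T) : T -> S -> R[i] :=
  fun y x => (\1_B y * \1_A x)%:C * W y x.

(** The matrix of the values of the truncated kernel at two tuples of points. *)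
Definition section_matrix n A B (x : n.-tuple S) (y : n.-tuple T) :
  'M[R[i]]_n :=
  \matrix_(i, j) truncated_kernel A B (tnth y i) (tnth x j).

(** The factorial moment of order [n] of the number of points in [A] of the process on
    [S] attached to [B], written in a form that is symmetric in [S] and [T]. It may
    be infinite. *)
Definition determinantal_moment (A : set S) (B : set T) (n : nat) : \bar R :=
  (\int[tensor_power lamS n]_x \int[tensor_power lamT n]_y
     (Normc.normc (\det (section_matrix A B x y)) ^+ 2 / n`!%:R)%:E)%E.

(** The diagonal of the correlation kernel, cut down to [A], with values in [0, +oo]. *)
Definition truncated_diagonal A B (x : S) : \bar R :=
  (\int[lamT]_y (Normc.normc (truncated_kernel A B y x) ^+ 2)%:E)%E.

Hypothesis mW : cmeasurable (fun z : T * S => W z.1 z.2).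
Variables (A : set S) (B : set T).
Hypotheses (mA : measurable A) (mB : measurable B).

Lemma cmeasurable_truncated :
  cmeasurable (fun z : T * S => truncated_kernel A B z.1 z.2).
Proof.
apply: cmeasurableM => //; apply: cmeasurable_real; apply: measurable_funM.
  exact: (measurableT_comp (measurable_indic mB)).
exact: (measurableT_comp (measurable_indic mA)).
Qed.

Lemma measurable_section_det n : measurable_fun setT
  (fun z : n.-tuple S * n.-tuple T =>
    (Normc.normc (\det (section_matrix A B z.1 z.2)) ^+ 2 / n`!%:R)%:E).
Proof.
apply/measurable_EFinP; apply: measurable_funM; last exact: measurable_cst.
apply: measurable_normc_sqr; apply: cmeasurable_det => i j.
apply: (cmeasurable_comp (h := fun z : n.-tuple S * n.-tuple T =>
  (tnth z.2 i, tnth z.1 j))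
  (f := fun z => truncated_kernel A B z.1 z.2));
    last exact: cmeasurable_truncated.
apply/measurable_fun_pairP; split => /=.
  exact: (measurableT_comp (measurable_tnth i)).
exact: (measurableT_comp (measurable_tnth j)).
Qed.

Lemma section_det_ge0 n (x : n.-tuple S) (y : n.-tuple T) :
  (0 <= (Normc.normc (\det (section_matrix A B x y)) ^+ 2 / n`!%:R)%:E)%E.
Proof. by rewrite lee_fin divr_ge0// sqr_ge0. Qed.

Lemma measurable_section_integral n : measurable_fun setT
  (fun x : n.-tuple S => \int[tensor_power lamT n]_y
     (Normc.normc (\det (section_matrix A B x y)) ^+ 2 / n`!%:R)%:E)%E.
Proof.
apply: (@measurable_fun_fubini_tonelli_F _ _ _ _ R (tensor_power lamT n)
  (fun z : n.-tuple S * n.-tuple T =>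
    (Normc.normc (\det (section_matrix A B z.1 z.2)) ^+ 2 / n`!%:R)%:E)).
  exact: measurable_section_det.
by move=> z; exact: section_det_ge0.
Qed.

Lemma measurable_truncated_diagonal : measurable_fun setT
  (truncated_diagonal A B).
Proof.
apply: (@measurable_fun_fubini_tonelli_F _ _ _ _ R lamT
  (fun z : S * T => (Normc.normc (truncated_kernel A B z.2 z.1) ^+ 2)%:E)).
  apply/measurable_EFinP; apply: measurable_normc_sqr.
  apply: (cmeasurable_comp (h := fun z : S * T => (z.2, z.1))
    (f := fun z => truncated_kernel A B z.1 z.2)).
    exact: measurable_fun_pair.
  exact: cmeasurable_truncated.
by move=> z; rewrite lee_fin sqr_ge0.
Qed.

Lemma truncated_diagonal_ge0 x : (0 <= truncated_diagonal A B x)%E.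
Proof. by apply: integral_ge0 => y _; rewrite lee_fin sqr_ge0. Qed.

(** The squared norm of [W y x] as a function of [y], infinite if that function is not
    square integrable. *)
Definition kernel_diagonal (x : S) : \bar R :=
  (\int[lamT]_y (Normc.normc (W y x) ^+ 2)%:E)%E.

Lemma measurable_kernel_diagonal : measurable_fun setT kernel_diagonal.
Proof.
apply: (@measurable_fun_fubini_tonelli_F _ _ _ _ R lamT
  (fun z : S * T => (Normc.normc (W z.2 z.1) ^+ 2)%:E)).
  apply/measurable_EFinP; apply: measurable_normc_sqr.
  apply: (cmeasurable_comp (h := fun z : S * T => (z.2, z.1))
    (f := fun z => W z.1 z.2)) => //.
  exact: measurable_fun_pair.
by move=> z; rewrite lee_fin sqr_ge0.
Qed.

Lemma kernel_diagonal_ge0 x : (0 <= kernel_diagonal x)%E.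
Proof. by apply: integral_ge0 => y _; rewrite lee_fin sqr_ge0. Qed.

Lemma normc_truncated_sqr y x :
  Normc.normc (truncated_kernel A B y x) ^+ 2 =
  \1_B y * \1_A x * Normc.normc (W y x) ^+ 2.
Proof.
rewrite /truncated_kernel !normc_sqrE ReM ImM /= !mul0r subr0 addr0 !exprMn.
rewrite -mulrDr !indicE; congr (_ * _).
by case: (y \in B); case: (x \in A); rewrite /= ?expr1n ?expr0n ?mul1r ?mul0r.
Qed.

Lemma cmeasurable_truncated_section x :
  cmeasurable (fun y => truncated_kernel A B y x).
Proof.
apply: (cmeasurable_comp (h := fun y : T => (y, x))
  (f := fun z => truncated_kernel A B z.1 z.2));
    last exact: cmeasurable_truncated.
exact: measurable_fun_pair.
Qed.

Lemma truncated_diagonal_le x :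
  (truncated_diagonal A B x <= (\1_A x)%:E * kernel_diagonal x)%E.
Proof.
have mN : measurable_fun setT (fun y => Normc.normc (W y x) ^+ 2).
  apply: measurable_normc_sqr.
  apply: (cmeasurable_comp (h := fun y : T => (y, x)) (f := fun z => W z.1 z.2))
    => //.
rewrite /kernel_diagonal -ge0_integralZl//; last 2 first.
- exact/measurable_EFinP.
- by move=> y _; rewrite lee_fin sqr_ge0.
apply: ge0_le_integral => //.
- by move=> y _; rewrite lee_fin sqr_ge0.
- by apply/measurable_EFinP;
  exact/measurable_normc_sqr/cmeasurable_truncated_section.
- by apply: measurable_funeM; exact/measurable_EFinP.
move=> y _; rewrite -EFinM lee_fin normc_truncated_sqr ler_wpM2r ?sqr_ge0//.
by rewrite !indicE; case: (y \in B); rewrite ?mul1r ?mul0r.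
Qed.

Lemma square_integrable_truncated x : (kernel_diagonal x < +oo)%E ->
  square_integrable lamT (fun y => truncated_kernel A B y x).
Proof.
move=> kx; split; first exact: cmeasurable_truncated_section.
apply: le_lt_trans (truncated_diagonal_le x) _.
by rewrite indicE lte_mul_pinfty.
Qed.

(** A point outside [A] gives a zero column. *)
Lemma section_integral_outside n (x : n.-tuple S) i : ~ A (tnth x i) ->
  (\int[tensor_power lamT n]_y
     (Normc.normc (\det (section_matrix A B x y)) ^+ 2 / n`!%:R)%:E = 0)%E.
Proof.
move=> nAx; apply: integral0_eq => y _.
have -> : \det (section_matrix A B x y) = 0.
  rewrite (expand_det_col _ i) big1// => j _.
  by rewrite mxE /truncated_kernel [\1_A _]indicE (memNset nAx) mulr0 !mul0r.
by rewrite Normc.normc0 expr0n mul0r.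
Qed.

(** On [A] the correlation kernel is a Gram matrix of truncated sections of [W]. *)
Lemma cintegral_kernel1 (x x' : S) : A x -> A x' ->
  kernel1 lamT W B x x' =
  cintegral lamT setT (fun y => (truncated_kernel A B y x)^* * truncated_kernel
    A B y x').
Proof.
move=> Ax Ax'.
have E y : (truncated_kernel A B y x)^* * truncated_kernel A B y x' =
    (\1_B y)%:C * ((W y x)^* * W y x').
  rewrite /truncated_kernel [\1_A x]indicE [\1_A x']indicE !mem_set// !mulr1.
  rewrite rmorphM/= (_ : (\1_B y)%:C^* = (\1_B y)%:C); last exact: conjc_real.
  rewrite mulrACA; congr (_ * _); rewrite -rmorphM/= indicE.
  by case: (y \in B); rewrite /= ?mulr1 ?mulr0.
rewrite (eq_cintegral _ E) /kernel1 /cintegral.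
rewrite Rintegral_mkcond [X in _ +i* X]Rintegral_mkcond.
congr (_ +i* _); apply: eq_Rintegral => y _; rewrite patchE indicE.
  by case: (y \in B); rewrite ?mul1r ?mul0r.
by case: (y \in B); rewrite ?mul1r ?mul0r.
Qed.

Lemma section_integral_det n (x : n.-tuple S) :
  (forall i, A (tnth x i)) ->
    (forall i, (kernel_diagonal (tnth x i) < +oo)%E) ->
  forall r : R, r%:C = \det (\matrix_(i, j) kernel1 lamT W B (tnth x i)
    (tnth x j)) ->
  (\int[tensor_power lamT n]_y
     (Normc.normc (\det (section_matrix A B x y)) ^+ 2 / n`!%:R)%:E = r%:E)%E.
Proof.
move=> xA kx r rE.
have sf i := square_integrable_truncated (kx i).
have [r' r'E rI] := andreief (lam := lamT)
  (f := fun (i : 'I_n) y => truncated_kernel A B y (tnth x i)) sf.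
suff -> : r = r' by exact: rI.
apply: complexI; rewrite rE -r'E; congr (\det _).
by apply/matrixP => i j; rewrite !mxE cintegral_kernel1.
Qed.

Hypothesis W_locally_finite : forall K : set S, compact K ->
  (\int[lamS]_(x in K) kernel_diagonal x < +oo)%E.

(** The points at which the section of [W] is not square integrable, where the
    correlation kernel takes junk values. *)
Definition singular_points : set S := [set x | kernel_diagonal x = +oo%E].

Lemma measurable_singular_points : measurable singular_points.
Proof.
rewrite -[X in measurable X]setTI.
exact: (measurable_kernel_diagonal measurableT (emeasurable_set1 +oo%E)).
Qed.

Lemma singular_points_null : lamS singular_points = 0%E.
Proof.
have [U [_ UC _ UT]] := exhaustion S.
apply/(negligibleP lamS measurable_singular_points).
rewrite -[singular_points]setIT -UT setI_bigcupr.
apply: negligible_bigcup => k; have [C cC UkC] := UC k.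
have mC := compact_measurable_base cC.
have iC : lamS.-integrable C kernel_diagonal.
  apply/integrableP; split.
    by apply: measurable_funTS; exact: measurable_kernel_diagonal.
  under eq_integral do rewrite gee0_abs ?kernel_diagonal_ge0//.
  exact: W_locally_finite.
apply: negligibleS (integrable_ae mC iC) => x [Zx /UkC Cx] /= /(_ Cx).
by rewrite Zx.
Qed.

Lemma ae_kernel_diagonal_fin n : {ae tensor_power lamS n, forall x,
  forall i, (kernel_diagonal (tnth x i) < +oo)%E}.
Proof.
apply: negligibleS (tensor_power_coord_null n measurable_singular_points
  singular_points_null) => x /= /existsNP[j].
by move/negP; rewrite -leNgt leye_eq => /eqP Zj; exists j.
Qed.

(** The set [D^n] of tuples with all coordinates in [D]. *)
Definition tuple_power n (D : set S) : set (n.-tuple S) :=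
  [set x | forall i, D (tnth x i)].

Lemma measurable_tuple_power n (D : set S) : measurable D -> measurable
  (@tuple_power n D).
Proof.
move=> mD; rewrite (_ : @tuple_power n D =
    \bigcap_(i in [set: 'I_n]) [set x | D (tnth x i)]); last first.
  by apply/seteqP; split => x h j; [move=> _; exact: h|exact: (h j I)].
apply: fin_bigcap_measurable => // i _.
by rewrite -[X in measurable X]setTI; exact: (measurable_tnth i measurableT mD).
Qed.

(** The integral of the determinantal correlation function over [A^n]; Andreief's
    identity applies at the tuples without singular coordinates, which is almost
    everywhere. *)
Lemma correlation_integralE n (rho : n.-tuple S -> R) :
  measurable_fun setT rho -> (forall x, 0 <= rho x) ->
  {ae tensor_power lamS n, forall x,
     (rho x)%:C = \det (\matrix_(i, j) kernel1 lamT W B (tnth x i)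
       (tnth x j))} ->
  (\int[tensor_power lamS n]_(x in @tuple_power n A) (rho x)%:E =
   determinantal_moment A B n)%E.
Proof.
move=> mrho rho0 rhoE; have mP := @measurable_tuple_power n A mA.
rewrite integral_mkcond /determinantal_moment.
apply: ae_eq_integral => //.
- rewrite -(measurable_restrictT _ mP).
  by apply: measurable_funTS; exact/measurable_EFinP.
- exact: measurable_section_integral.
apply: filterS2 rhoE (ae_kernel_diagonal_fin n) => x rE kx _.
rewrite patchE; have [|nxA] := boolP (x \in @tuple_power n A).
  by rewrite inE => xA; rewrite (section_integral_det xA kx rE).
have /existsNP [j nAj] : ~ tuple_power A x by move=> h; move: nxA;
  rewrite mem_set.
by rewrite (section_integral_outside nAj).
Qed.

(** Hadamard's inequality for the Gram matrix, integrated over the points of [S]. *)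
Lemma determinantal_moment_hadamard n :
  (determinantal_moment A B n <=
    \prod_(i < n) \int[lamS]_x truncated_diagonal A B x)%E.
Proof.
have mD := measurable_truncated_diagonal.
rewrite -(ge0_tensor_integral_prod lamS (F := fun _ => truncated_diagonal A
  B))//; last first.
  by move=> i x; exact: truncated_diagonal_ge0.
apply: ae_ge0_le_integral => //.
- by move=> x _; apply: integral_ge0 => y _; exact: section_det_ge0.
- exact: measurable_section_integral.
- by move=> x _; apply: prode_ge0 => i _; exact: truncated_diagonal_ge0.
- exact: (measurable_tensor_prod (F := fun _ => truncated_diagonal A B)).
apply: filterS (ae_kernel_diagonal_fin n) => x kx _.
exact: (andreief_hadamard (f := fun (i : 'I_n) y => truncated_kernel A B y
  (tnth x i))
  (fun i => square_integrable_truncated (kx i))).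
Qed.

Lemma determinantal_moment0 : determinantal_moment A B 0 = 1%E.
Proof.
rewrite /determinantal_moment.
under eq_integral do under eq_integral do
  rewrite det_mx00 Normc.normc1 expr1n fact0 divr1.
have DS : (tensor_power lamS 0 setT = 1)%E by exact: diracT.
have DT : (tensor_power lamT 0 setT = 1)%E by exact: diracT.
have IT : (\int[tensor_power lamT 0]__ 1 = 1)%E.
  transitivity (1 * tensor_power lamT 0 setT)%E; first exact: integral_cst.
  by rewrite DT mul1e.
under eq_integral do rewrite IT.
transitivity (1 * tensor_power lamS 0 setT)%E; first exact: integral_cst.
by rewrite DS mul1e.
Qed.

Lemma determinantal_moment1 :
  determinantal_moment A B 1 = (\int[lamS]_x truncated_diagonal A B x)%E.
Proof.
rewrite -(tensor_power1_integral lamS measurable_truncated_diagonal);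
  last first.
  by move=> x; exact: truncated_diagonal_ge0.
apply: eq_integral => x _; rewrite /truncated_diagonal.
rewrite -(tensor_power1_integral lamT (f := fun y =>
   (Normc.normc (truncated_kernel A B y (tnth x ord0)) ^+ 2)%:E)).
- by apply: eq_integral => y _; rewrite det_mx11 mxE (_ : 1`! = 1%N)// divr1.
- by apply/measurable_EFinP;
  exact/measurable_normc_sqr/cmeasurable_truncated_section.
- by move=> y; rewrite lee_fin sqr_ge0.
Qed.

Lemma determinantal_moment_le n :
  (determinantal_moment A B n <= determinantal_moment A B 1 ^+ n)%E.
Proof.
rewrite (le_trans (determinantal_moment_hadamard n))// determinantal_moment1.
elim: n => [|n IH]; first by rewrite big_ord0 expe0.
rewrite big_ord_recl expeS lee_wpmul2l//.
by apply: integral_ge0 => x _; exact: truncated_diagonal_ge0.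
Qed.

Lemma determinantal_moment_ge0 n : (0 <= determinantal_moment A B n)%E.
Proof. by apply: integral_ge0 => x _; apply: integral_ge0 => y _;
  exact: section_det_ge0. Qed.

Lemma determinantal_moment1_fin (C : set S) : compact C -> A `<=` C ->
  (determinantal_moment A B 1 < +oo)%E.
Proof.
move=> cC AC; rewrite determinantal_moment1.
have mC := compact_measurable_base cC.
apply: le_lt_trans (W_locally_finite cC).
rewrite [leRHS]integral_mkcond; apply: ge0_le_integral => //.
- by move=> x _; exact: truncated_diagonal_ge0.
- exact: measurable_truncated_diagonal.
- by apply/(measurable_restrictT _ mC); apply: measurable_funTS;
  exact: measurable_kernel_diagonal.
move=> x _; apply: (le_trans (truncated_diagonal_le x)).
rewrite patchE indicE; have [|_] := boolP (x \in A); last first.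
  by rewrite mul0e; case: ifP => // _; exact: kernel_diagonal_ge0.
by rewrite inE => /AC xC; rewrite mem_set// mul1e.
Qed.

End determinantal_moment.

Section determinantal_moment_symmetry.
Context (R : realType) (dS dT : measure_display).
Context (S : baseSpaceType dS) (T : baseSpaceType dT).
Variables (lamS : {sigma_finite_measure set S -> \bar R})
  (lamT : {sigma_finite_measure set T -> \bar R}).
Variable W : T -> S -> R[i].
Hypothesis mW : cmeasurable (fun z : T * S => W z.1 z.2).
Variables (A : set S) (B : set T).
Hypotheses (mA : measurable A) (mB : measurable B).

(** The integral kernel of the adjoint operator. *)
Definition adjoint_kernel : S -> T -> R[i] := fun x y => (W y x)^*.

Lemma normc_conjC (z : R[i]) : Normc.normc z^* = Normc.normc z.
Proof. by case: z => a b; rewrite /Normc.normc/= sqrrN. Qed.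

Lemma section_matrix_adjoint n (x : n.-tuple S) (y : n.-tuple T) :
  section_matrix adjoint_kernel B A y x =
  (map_mx Num.conj (section_matrix W A B x y))^T.
Proof.
apply/matrixP => i j; rewrite !mxE /truncated_kernel /adjoint_kernel !rmorphM/=.
have CR (r : R) : (r%:C)^* = r%:C :> R[i] by exact: conjc_real.
by rewrite !CR; congr (_ * _); exact: mulrC.
Qed.

(** Tonelli's theorem; exchanging the roles of the two spaces transposes and
    conjugates the matrix, which does not change the modulus of its determinant. *)
Lemma determinantal_moment_symm n :
  determinantal_moment lamS lamT W A B n =
  determinantal_moment lamT lamS adjoint_kernel B A n.
Proof.
rewrite /determinantal_moment.
apply: etrans (@fubini_tonelli _ _ _ _ R (tensor_power lamS n)
  (tensor_power lamT n)
   (fun z : n.-tuple S * n.-tuple T =>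
     (Normc.normc (\det (section_matrix W A B z.1 z.2)) ^+ 2 / n`!%:R)%:E)
    _ _) _.
- exact: measurable_section_det.
- by move=> z; exact: section_det_ge0.
- apply: eq_integral => y _; apply: eq_integral => x _ /=.
  by rewrite section_matrix_adjoint det_tr det_map_mx normc_conjC.
Qed.

End determinantal_moment_symmetry.

Section determinantal_process_counts.
Context (R : realType) (dS dT : measure_display).
Context (S : baseSpaceType dS) (T : baseSpaceType dT).
Variables (lamS : {sigma_finite_measure set S -> \bar R})
  (lamT : {sigma_finite_measure set T -> \bar R}).
Variable W : T -> S -> R[i].
Hypothesis mW : cmeasurable (fun z : T * S => W z.1 z.2).
Hypothesis W_locally_finite : forall K : set S, compact K ->
  (\int[lamS]_(x in K) kernel_diagonal lamT W x < +oo)%E.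
Variables (A : set S) (B : set T).
Hypotheses (mA : measurable A) (mB : measurable B).
Context (e : measure_display) (Omega : measurableType e).
Variables (P : probability Omega R) (Xi : {RV P >-> conf R S}).
Hypothesis dpp : is_DPP Xi (kernel1 lamT W B) lamS.

Lemma power_rectangle1 n (D : set S) :
  power_rectangle (fun _ : 'I_1 => D) (fun=> n) n = @tuple_power _ S n D.
Proof.
have E : flatten [seq nseq n D | j <- enum 'I_1] = nseq n D.
  rewrite (_ : [seq nseq n D | j <- enum 'I_1] = [:: nseq n D]) /= ?cats0//.
  by rewrite enum_ordSl/= (size0nil (size_enum_ord 0)).
by apply/seteqP; split => x h j; have := h j; rewrite E nth_nseq ltn_ord.
Qed.

(** The correlation measure of order [n] at the cube [D^n], also for unbounded [D]. *)
Lemma dpp_correlation n : (0 < n)%N ->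
  exists2 nu : {measure set (n.-tuple S) -> \bar R}, is_correlation_measure Xi
    nu &
    forall D, measurable D ->
      nu (tuple_power D) = determinantal_moment lamS lamT W D B n.
Proof.
move=> n0; have [_ /(_ n n0)[rho [mrho rho0 [nu cnu nuE]] rhoE]] := dpp.
exists nu => // D mD; rewrite nuE; last exact: measurable_tuple_power.
exact: (correlation_integralE mW mD mB W_locally_finite mrho rho0 rhoE).
Qed.

Lemma dpp_factorial_moment n D : bounded_borel D ->
  (\int[P]_w ((npoints (Xi w) D) ^_ n)%:R%:E = determinantal_moment lamS lamT W
    D B n)%E.
Proof.
move=> bD; have mD := bD.1; case: n => [|n].
  rewrite determinantal_moment0.
  under eq_integral do rewrite ffactn0.
  by rewrite integral_cst// mul1e; exact: probability_setT.
have [//|nu [_ cor] nuE] := @dpp_correlation n.+1.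
rewrite -nuE// -power_rectangle1.
have := cor 1%N (fun=> D) (fun=> n.+1) (fun=> bD).
rewrite big_ord1 => <- //; last first.
  by move=> i j _ _ _; rewrite (ord1 i) (ord1 j).
rewrite unlock; apply: eq_integral => w _.
by rewrite big_ord1.
Qed.

Variable U : nat -> set S.
Hypotheses (oU : forall k, open (U k))
  (cU : forall k, exists2 C, compact C & U k `<=` C)
  (ndU : nondecreasing_seq U) (UT : \bigcup_k U k = setT).

Let mU k : measurable (U k) := open_measurable_base (oU k).
Let mAU k : measurable (A `&` U k) := measurableI _ _ mA (mU k).
Let bAU k : bounded_borel (A `&` U k) := bounded_borelI (cU k) (mAU k).

Lemma nondecreasing_setI_exhaustion : nondecreasing_seq (fun k => A `&` U k).
Proof.
move=> k l kl; apply/subsetPset => x [Ax Ux]; split => //.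
by have /subsetPset := ndU kl; apply.
Qed.

Lemma bigcup_setI_exhaustion : \bigcup_k (A `&` U k) = A.
Proof. by rewrite -setI_bigcupr UT setIT. Qed.

(** The number of points of the process in the part of [A] that lies in the [k]-th set
    of the exhaustion. *)
Definition window_count (k : nat) (w : Omega) : nat := npoints (Xi w)
  (A `&` U k).

(** The factorial moment of order [n] of [window_count k]; it is finite by
    [window_moment1_fin] and Hadamard's inequality, so [fine] loses nothing. *)
Definition window_moment (k n : nat) : R :=
  fine (determinantal_moment lamS lamT W (A `&` U k) B n).

Lemma window_moment1_fin k :
  (determinantal_moment lamS lamT W (A `&` U k) B 1 < +oo)%E.
Proof.
have [C cC UC] := cU k.
apply: (determinantal_moment1_fin mW (mAU k) mB W_locally_finite cC).
by move=> x [_ /UC].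
Qed.

Lemma window_momentK k n :
  (window_moment k n)%:E = determinantal_moment lamS lamT W (A `&` U k) B n.
Proof.
rewrite fineK// ge0_fin_numE; last exact: determinantal_moment_ge0.
apply: (le_lt_trans (determinantal_moment_le mW (mAU k) mB W_locally_finite n)).
rewrite -[determinantal_moment _ _ _ _ _ 1]fineK; last first.
  by rewrite ge0_fin_numE;
    [exact: window_moment1_fin|exact: determinantal_moment_ge0].
by rewrite -EFin_expe ltry.
Qed.

Lemma cvg_window_moment n :
  (window_moment k n)%:E @[k --> \oo] -->
  determinantal_moment lamS lamT W A B n.
Proof.
case: n => [|n].
  under eq_fun do rewrite window_momentK determinantal_moment0.
  by rewrite determinantal_moment0; exact: cvg_cst.
have [//|nu _ nuE] := @dpp_correlation n.+1.
under eq_fun do rewrite window_momentK -nuE//.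
rewrite -nuE//.
have -> : @tuple_power _ S n.+1 A = \bigcup_k @tuple_power _ S n.+1 (A `&` U k).
  apply/seteqP; split => [x Ax|x [k _ h] j]; last by have [] := h j.
  have Ux j : exists k, U k (tnth x j).
    by have : [set: S] (tnth x j) by []; rewrite -UT => -[k _ Ukx]; exists k.
  have [g gP] := choice Ux.
  exists (\max_j g j) => // j; split; first exact: Ax.
  have /ndU/subsetPset : (g j <= \max_j g j)%N by exact: leq_bigmax.
  by apply; exact: gP.
apply: nondecreasing_cvg_mu.
- by move=> k; exact: measurable_tuple_power.
- by apply: bigcupT_measurable => k; exact: measurable_tuple_power.
- move=> k l kl; apply/subsetPset => x h j.
  by have /subsetPset := nondecreasing_setI_exhaustion kl; apply.
Qed.

Lemma window_count_nondecreasing w : nondecreasing_seq (window_count ^~ w).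
Proof.
move=> k l kl; rewrite leEnat -(ler_nat R) -lee_fin.
rewrite -(conf_bounded_natP (Xi w) (bAU k)) -(conf_bounded_natP (Xi w) (bAU l)).
apply: le_measure; rewrite ?inE//.
exact/subsetPset/nondecreasing_setI_exhaustion.
Qed.

(** The windows [A `&` U k] increase to [A]; the moments converge by continuity from
    below of the correlation measures. *)
Lemma window_exhausts : exhausts P window_count window_moment
  (determinantal_moment lamS lamT W A B).
Proof.
split.
- move=> k; apply: (measurableT_comp (measurable_npoints (oU k) (cU k) mA)).
  exact: measurable_funPT.
- exact: window_count_nondecreasing.
- by move=> k n; rewrite window_momentK; exact: dpp_factorial_moment.
- move=> k n; rewrite -lee_fin EFin_expe !window_momentK.
  exact: determinantal_moment_le.
split; last exact: cvg_window_moment.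
have [//|nu _ nuE] := @dpp_correlation 1.
move=> k; rewrite window_momentK -!nuE//.
apply: le_measure; rewrite ?inE//; try exact: measurable_tuple_power.
by move=> x h j; have [] := h j.
Qed.

(** The total count of [A], which may be infinite, is the supremum of the counts in
    the windows. *)
Lemma count_eq_window m : count_eq window_count m = [set w | Xi w A = m%:R%:E].
Proof.
have cvgXi w : (window_count k w)%:R%:E @[k --> \oo] --> Xi w A.
  under eq_fun do rewrite -(conf_bounded_natP (Xi w) (bAU _)).
  have := @nondecreasing_cvg_mu _ _ _ (Xi w) (fun k => A `&` U k) mAU.
  rewrite bigcup_setI_exhaustion => /(_ mA nondecreasing_setI_exhaustion).
  exact.
have le_limit w k : ((window_count k w)%:R%:E <= Xi w A)%E.
  rewrite -(conf_bounded_natP (Xi w) (bAU k)); apply: le_measure;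
    rewrite ?inE//.
have limit_le w m' : (forall k, (window_count k w <= m')%N) ->
  (Xi w A <= m'%:R%:E)%E.
  move=> h; rewrite -(cvg_lim _ (cvgXi w))//; apply: lime_le.
    by apply/cvg_ex; eexists; exact: cvgXi.
  by apply: nearW => k; rewrite lee_fin ler_nat.
apply/seteqP; split => [w [below notbelow]|w /= XiA].
  apply/eqP; rewrite eq_le limit_le//=.
  move/existsNP: notbelow => [k /negP]; rewrite -leqNgt => mk.
  by rewrite (le_trans _ (le_limit w k))// lee_fin ler_nat.
have below k : (window_count k w <= m)%N.
  by have := le_limit w k; rewrite XiA lee_fin ler_nat.
split => // notbelow; case: m XiA below notbelow => [|m] XiA _ notbelow.
  by have := notbelow 0%N; rewrite ltn0.
have wm k : (window_count k w <= m)%N by have := notbelow k.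
by have := limit_le w m wm; rewrite XiA lee_fin ler_nat ltnn.
Qed.

End determinantal_process_counts.

(** * Equality of the laws *)

Section statement_hypotheses.
Context (R : realType).

Lemma L2norm_sqrE d (T : measurableType d) (mu : {measure set T -> \bar R})
    (f : T -> R[i]) :
  (L2norm mu f ^+ 2 = \int[mu]_x (Normc.normc (f x) ^+ 2)%:E)%E.
Proof.
rewrite /L2norm unlock /=.
under eq_integral => x _.
  rewrite powR_mulrn// real_normK; last exact: num_real.
  over.
rewrite poweR12_sqrt; last by apply: integral_ge0 => x _;
  rewrite lee_fin sqr_ge0.
by apply: sqr_sqrte; apply: integral_ge0 => x _; rewrite lee_fin sqr_ge0.
Qed.

Lemma radon_sigma_finite d (S : baseSpaceType d)
  (lam : {measure set S -> \bar R}) :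
  radon lam -> sigma_finite setT lam.
Proof.
move=> [fin _ _]; have [U [oU cU _ UT]] := exhaustion S.
exists U => // k; split; first exact: open_measurable_base.
have [C cC UC] := cU k; apply: le_lt_trans (fin C cC).
apply: le_measure; rewrite ?inE//; first exact: open_measurable_base.
exact: compact_measurable_base.
Qed.

(** The process on the second space is of the same form as that on the first, for the
    adjoint kernel. *)
Lemma kernel2_adjoint d1 d2 (S1 : baseSpaceType d1) (S2 : baseSpaceType d2)
    (lam1 : {measure set S1 -> \bar R}) (W : S2 -> S1 -> R[i]) (D : set S1) :
  kernel2 lam1 W D = kernel1 lam1 (adjoint_kernel W) D.
Proof.
apply/funext => y; apply/funext => y'; congr cintegral.
by apply/funext => x; rewrite /adjoint_kernel conjCK.
Qed.

Lemma cmeasurable_adjoint d1 d2 (S1 : measurableType d1)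
  (S2 : measurableType d2)
    (W : S2 -> S1 -> R[i]) :
  cmeasurable (fun z : S2 * S1 => W z.1 z.2) ->
  cmeasurable (fun z : S1 * S2 => (W z.2 z.1)^*).
Proof.
move=> mW.
have [mR mI] : cmeasurable (fun z : S1 * S2 => W z.2 z.1).
  apply: (cmeasurable_comp (h := fun z : S1 * S2 => (z.2, z.1))
    (f := fun z => W z.1 z.2)) => //.
  exact: measurable_fun_pair.
split; first by under eq_fun do rewrite Re_conjC.
by under eq_fun do rewrite Im_conjC; exact: measurable_funN.
Qed.

(** The equality of laws needs only that both kernels be locally square integrable:
    both counts have the same factorial moments. *)
Lemma dpp_duality d1 d2 (S1 : baseSpaceType d1) (S2 : baseSpaceType d2)
    (lam1 : {sigma_finite_measure set S1 -> \bar R})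
    (lam2 : {sigma_finite_measure set S2 -> \bar R})
    (W : S2 -> S1 -> R[i])
    (mW : cmeasurable (fun z : S2 * S1 => W z.1 z.2))
    (fin1 : forall K : set S1, compact K ->
      (\int[lam1]_(x in K) kernel_diagonal lam2 W x < +oo)%E)
    (fin2 : forall K : set S2, compact K ->
      (\int[lam2]_(y in K) kernel_diagonal lam1 (adjoint_kernel W) y < +oo)%E)
    (A : set S1) (B : set S2) (mA : measurable A) (mB : measurable B)
    e1 e2 (Omega1 : measurableType e1) (Omega2 : measurableType e2)
    (P1 : probability Omega1 R) (P2 : probability Omega2 R)
    (Xi1 : {RV P1 >-> conf R S1}) (Xi2 : {RV P2 >-> conf R S2}) :
  is_DPP Xi1 (kernel1 lam2 W B) lam1 ->
  is_DPP Xi2 (kernel1 lam1 (adjoint_kernel W) A) lam2 ->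
  forall m : nat,
    P1 [set w | Xi1 w A = m%:R%:E] = P2 [set w | Xi2 w B = m%:R%:E].
Proof.
move=> dpp1 dpp2 m.
have mW' := cmeasurable_adjoint mW.
have [U1 [oU1 cU1 ndU1 UT1]] := exhaustion S1.
have [U2 [oU2 cU2 ndU2 UT2]] := exhaustion S2.
rewrite -(count_eq_window mA Xi1 oU1 cU1 ndU1 UT1).
rewrite -(count_eq_window mB Xi2 oU2 cU2 ndU2 UT2).
apply: (exhausts_unique m (window_exhausts mW fin1 mA mB dpp1 oU1 cU1 ndU1
  UT1)).
rewrite (funext (determinantal_moment_symm lam1 lam2 mW mA mB)).
exact: (window_exhausts mW' fin2 mB mA dpp2 oU2 cU2 ndU2 UT2).
Qed.

End statement_hypotheses.

Theorem theorem2p6 (R : realType) (d1 d2 : measure_display)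
    (S1 : baseSpaceType d1) (S2 : baseSpaceType d2)
    (lam1 : {measure set S1 -> \bar R}) (lam2 : {measure set S2 -> \bar R})
    (radon1 : radon lam1) (radon2 : radon lam2)
    (Wop : (S1 -> R[i]) -> (S2 -> R[i])) (Wadj : (S2 -> R[i]) -> (S1 -> R[i]))
    (W : S2 -> S1 -> R[i])
    (Wop_isometry : partial_isometry lam1 lam2 Wop)
    (Wop_adjoint : is_adjoint lam1 lam2 Wop Wadj)
    (Wop_locHS : locally_hilbert_schmidt lam1 lam2 Wop)
    (Wadj_locHS : locally_hilbert_schmidt lam2 lam1 Wadj)
    (W_kernel : is_integral_kernel lam1 lam2 Wop Wadj W)
    (Lambda1 : set S1) (Lambda2 : set S2)
    (mLambda1 : measurable Lambda1) (mLambda2 : measurable Lambda2)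
    (e1 e2 : measure_display)
    (Omega1 : measurableType e1) (Omega2 : measurableType e2)
    (P1 : probability Omega1 R) (P2 : probability Omega2 R)
    (Xi1 : {RV P1 >-> conf R S1}) (Xi2 : {RV P2 >-> conf R S2})
    (dpp1 : is_DPP Xi1 (kernel1 lam2 W Lambda2) lam1)
    (dpp2 : is_DPP Xi2 (kernel2 lam1 W Lambda1) lam2) :
  forall m : nat,
    P1 [set omega | Xi1 omega Lambda1 = m%:R%:E] =
    P2 [set omega | Xi2 omega Lambda2 = m%:R%:E].
Proof.
have [mW fin1 fin2 _ _] := W_kernel.
have [m1 E1] := sigma_finite_measureP (radon_sigma_finite radon1).
have [m2 E2] := sigma_finite_measureP (radon_sigma_finite radon2).
subst lam1 lam2.
apply: (dpp_duality mW _ _ mLambda1 mLambda2 dpp1).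
- move=> K cK; apply: le_lt_trans (fin1 K cK).
  rewrite le_eqVlt; apply/orP; left; apply/eqP.
  by apply: eq_integral => x _; rewrite L2norm_sqrE.
- move=> K cK; apply: le_lt_trans (fin2 K cK).
  rewrite le_eqVlt; apply/orP; left; apply/eqP.
  apply: eq_integral => y _; rewrite L2norm_sqrE.
  by apply: eq_integral => x _; rewrite normc_conjC.
- by rewrite -kernel2_adjoint.
Qed.
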